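(* Let $K\subset\mathbb{R}^n$ be a convex body. Then there exists $A\in\mathrm{GL}_n(\mathbb{R})$ such that \[ \operatorname{iwq}(AK)\ \le\ 1, \] and, moreover, equality holds if and only if $AK$ is a cube.
   Context: A convex body in $\mathbb{R}^n$ is a compact convex set with nonempty interior. For $u\in\mathbb{S}^{n-1}$, let $h(K,u)=\max\{x^{\intercal}u:x\in K\}$; the minimum width of $K$ is $\mathrm{w}(K)=\min_{u\in\mathbb{S}^{n-1}}\big(h(K,u)+h(K,-u)\big)$. The isominwidth quotient is $\operatorname{iwq}(K)=\mathrm{vol}(K)/\mathrm{w}(K)^n$, with $\mathrm{vol}$ the $n$-dimensional volume. A cube is any image of $[-1,1]^n$ under a composition of orthogonal transformations, positive scalings and translations. *)

(* Defs.v *)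
From HB Require Import structures.
From mathcomp Require Import all_boot all_order all_algebra.
From mathcomp Require Import all_classical all_reals all_analysis.

Set Implicit Arguments.
Unset Strict Implicit.
Unset Printing Implicit Defensive.

Import Order.TTheory GRing.Theory Num.Theory.
Import numFieldNormedType.Exports.

Local Open Scope classical_set_scope.
Local Open Scope ring_scope.

(* Lebesgue measure on R^n, carried by [n.-tuple R]: the unit mass for n = 0,
   and the image of the product measure on R * R^n under (x, t) |-> x :: t for
   the successor. The sigma-finiteness proofs are what [\x] needs to iterate. *)
Section lebesgue_tuple.
Context {R : realType}.
Local Notation mR := (measurableTypeR R).

Definition tuple_cons n (p : mR * n.-tuple mR) : n.+1.-tuple mR :=
  [the n.+1.-tuple mR of p.1 :: p.2].

Definition tuple_uncons n (t : n.+1.-tuple mR) : mR * n.-tuple mR :=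
  (tnth t ord0, [tuple of behead t]).

Lemma tuple_consK n : cancel (@tuple_cons n) (@tuple_uncons n).
Proof. by move=> [x t]; congr pair; apply/val_inj. Qed.

Lemma measurable_tuple_cons n : measurable_fun setT (@tuple_cons n).
Proof. exact: measurable_cons. Qed.

Lemma measurable_tuple_uncons n : measurable_fun setT (@tuple_uncons n).
Proof.
apply: measurable_fun_pair; first exact: measurable_tnth.
exact: measurable_behead.
Qed.

Section zero.

Definition lebesgue_tuple0 : set (0.-tuple mR) -> \bar R := \d_[tuple].

Let mu0 : lebesgue_tuple0 set0 = 0%E. Proof. exact: measure0. Qed.

Let mu_ge0 A : (0 <= lebesgue_tuple0 A)%E. Proof. exact: measure_ge0. Qed.

Let mu_sigma_additive : semi_sigma_additive lebesgue_tuple0.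
Proof. exact: measure_semi_sigma_additive. Qed.

HB.instance Definition _ := isMeasure.Build _ _ _ lebesgue_tuple0
  mu0 mu_ge0 mu_sigma_additive.

Let mu_sigma_finite : sigma_finite setT lebesgue_tuple0.
Proof.
exists (fun=> setT); first by rewrite bigcup_const//; exists 0%N.
by move=> _; split => //; rewrite /lebesgue_tuple0 diracT ltry.
Qed.

HB.instance Definition _ := Measure_isSigmaFinite.Build _ _ _
  lebesgue_tuple0 mu_sigma_finite.

End zero.

Section succ.
Variables (n : nat) (nu : {sigma_finite_measure set (n.-tuple mR) -> \bar R}).

Definition lebesgue_tupleS : set (n.+1.-tuple mR) -> \bar R :=
  pushforward (@lebesgue_measure R \x nu)%E (@tuple_cons n).

Let mcons := @measurable_tuple_cons n.

Let mu0 : lebesgue_tupleS set0 = 0%E.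
Proof. by rewrite /lebesgue_tupleS /pushforward preimage_set0 measure0. Qed.

Let mu_ge0 A : (0 <= lebesgue_tupleS A)%E.
Proof. exact: measure_ge0. Qed.

Let mu_sigma_additive : semi_sigma_additive lebesgue_tupleS.
Proof.
pose m := [the measure _ _ of (@lebesgue_measure R \x nu)%E].
exact: (@measure_semi_sigma_additive _ _ _
  (measure_function_pushforward__canonical__measure_function_Measure m mcons)).
Qed.

HB.instance Definition _ := isMeasure.Build _ _ _ lebesgue_tupleS
  mu0 mu_ge0 mu_sigma_additive.

Let mu_sigma_finite : sigma_finite setT lebesgue_tupleS.
Proof.
have /sigma_finiteP[F [FT ndF Foo]] := sigma_finiteT (@lebesgue_measure R).
have /sigma_finiteP[G [GT ndG Goo]] := sigma_finiteT nu.
exists (fun k => @tuple_uncons n @^-1` (F k `*` G k)).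
  apply/esym; rewrite -subTset => t _.
  have [i _ Fi] : (\bigcup_k F k) (tuple_uncons t).1 by rewrite -FT.
  have [j _ Gj] : (\bigcup_k G k) (tuple_uncons t).2 by rewrite -GT.
  exists (maxn i j) => //; split.
    exact: (subsetPset _ _ (ndF _ _ (leq_maxl i j))).
  exact: (subsetPset _ _ (ndG _ _ (leq_maxr i j))).
move=> k; have [mF Fk] := Foo k; have [mG Gk] := Goo k.
have mFG : measurable (F k `*` G k) by exact: measurableX.
split; first by rewrite -[X in measurable X]setTI; exact: measurable_tuple_uncons.
rewrite /lebesgue_tupleS /pushforward -comp_preimage.
rewrite (_ : _ \o _ = id); last exact/funext/tuple_consK.
by rewrite preimage_id product_measure1E// lte_mul_pinfty// ge0_fin_numE.
Qed.

HB.instance Definition _ := Measure_isSigmaFinite.Build _ _ _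
  lebesgue_tupleS mu_sigma_finite.

End succ.

Fixpoint lebesgue_tuple n : {sigma_finite_measure set (n.-tuple mR) -> \bar R} :=
  if n is m.+1 then lebesgue_tupleS (lebesgue_tuple m) else lebesgue_tuple0.

End lebesgue_tuple.

Section convex_bodies.
Context {R : realType} {n : nat}.
Implicit Types (K : set 'cV[R]_n) (u x : 'cV[R]_n) (A : 'M[R]_n).

Definition dotv x u : R := (x^T *m u) ord0 ord0.

Definition convex_body K : Prop :=
  [/\ compact K, convex_set K & K° !=set0].

Definition support_fun K u : R := sup [set dotv x u | x in K].

Definition unit_sphere : set 'cV[R]_n := [set u | dotv u u = 1].

(* The maximum and minimum of the textbook definitions are taken as [sup] and
   [inf]; they are attained when K is a convex body and 0 < n. *)
Definition width K : R :=
  inf [set support_fun K u + support_fun K (- u) | u in unit_sphere].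

Definition volume K : \bar R :=
  lebesgue_tuple n [set t | K (\col_i tnth t i)].

Definition iwq K : R := fine (volume K) / width K ^+ n.

Definition linear_image A K : set 'cV[R]_n := [set A *m x | x in K].

Definition orthogonal_mx A : Prop := A *m A^T = 1%:M.

Definition std_cube : set 'cV[R]_n := [set x | forall i, `|x i ord0| <= 1].

(* Every composition of orthogonal transformations, positive scalings and
   translations has the form x |-> c Q x + t. *)
Definition is_cube K : Prop :=
  exists (Q : 'M[R]_n) (c : R) (t : 'cV[R]_n),
    [/\ orthogonal_mx Q, 0 < c &
        K = [set c *: (Q *m x) + t | x in std_cube]].

End convex_bodies.

(* Main.v *)
(* Put K in the position where the Euclidean ball is the ellipsoid of largest
   volume inside the difference body K - K. John's theorem then gives unit
   directions u_i, in each of which K has width exactly 1, and weights c_i >= 0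
   with sum c_i u_i u_i^T = 1, while the width is at least 1 in every direction.
   So K lies in an intersection L of slabs a_i <= u_i . x <= a_i + 1, and it
   remains to see that vol(L) <= 1, which is Ball's volume ratio theorem.

   Barthe's transport argument proves it: let T be the inverse of the standard
   normal distribution function and Theta(x) = sum c_i T(u_i . x - a_i) u_i. Then
   det (D Theta) >= prod (T')^(c_i), the Jacobian of Theta^-1 is bounded by the
   Gaussian density, and vol(L) <= 1. In place of a change of variables, the image
   of Theta is covered by small cubes, the preimage of each of which lies in a
   parallelepiped. The determinant inequality is strict somewhere unless any two
   of the u_i are parallel or orthogonal, in which case L is a unit cube. *)
Require Import Defs.
From HB Require Import structures.
From mathcomp Require Import all_boot all_order all_algebra.
From mathcomp Require Import all_classical all_reals all_analysis.
From mathcomp Require Import ring lra zify.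
From mathcomp Require Import complex.

Set Implicit Arguments.
Unset Strict Implicit.
Unset Printing Implicit Defensive.

Import Order.TTheory GRing.Theory Num.Theory.
Import numFieldNormedType.Exports.

Local Open Scope classical_set_scope.
Local Open Scope ring_scope.

(** * Volume in R^n under affine maps *)

(** The width of [K] in direction [u] is the support function of K - K at [u]. Hence the image of
    the unit ball under B^T lies in K - K exactly when |B u| <= [dirwidth K u] for all [u], and
    John's position becomes a maximum of the determinant over such B. The Gaussian bound rests on
    two consequences of sum c_i u_i u_i^T = 1: the c_i add up to n, and |Theta|^2 <= sum c_i T_i^2.
    With them the product of the gauss(T_i)^(c_i) is at most the standard density at Theta. The
    obstacle is that T' blows up at the faces of the slabs. All estimates are therefore made on
    slabs shrunk by r > 0, with constants depending on r; the side of the grid tends to 0 for fixed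
    r, and the shrinking is then removed by a homothety about an interior point. Strictness has to
    survive both limits, so the gain of the determinant on a small set enters the bound as a
    separate volume term on which neither limit acts. *)

Section volume_theory.
Context {R : realType}.
Local Notation mR := (measurableTypeR R).
Local Notation mu := (@lebesgue_measure R).

Definition col_of_tuple n (t : n.-tuple mR) : 'cV[R]_n := \col_i tnth t i.

Definition meas n (X : set 'cV[R]_n) : Prop :=
  measurable (@col_of_tuple n @^-1` X).

Lemma volumeE n (X : set 'cV[R]_n) :
  volume X = lebesgue_tuple n (@col_of_tuple n @^-1` X).
Proof. by []. Qed.

(** By uniqueness of Lebesgue measure it suffices to compare values on half-open intervals. For
    negative [a] the preimage is closed at the other end, hence the two interval formulas [moc] and
    [mco]. *)
Lemma lebesgue_measure_affine (a b : R) (X : set mR) : a != 0 ->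
  measurable X -> mu [set x | X (a * x + b)] = (`|a|^-1%:E * mu X)%E.
Proof.
move=> a0 mX; pose f (x : mR) : mR := a * x + b.
have mf : measurable_fun setT f.
  by apply: measurable_realfun.measurable_funD => //;
    exact: measurable_realfun.measurable_funM.
have an0 : 0 <= `|a| by [].
pose m1 := [the measure _ _ of
  measure_function_pushforward__canonical__measure_function_Measure mu mf].
pose m := [the measure _ _ of mscale (NngNum an0) m1].
have mE Y : m Y = (`|a|%:E * mu [set x | Y (a * x + b)%R])%E by [].
have moc x y : mu `]x, y]%classic = (if x < y then (y - x)%:E else 0%E).
  by have := lebesgue_measure_itv `]x, y]; rewrite /= lte_fin -EFinB.
have mco x y : mu `[x, y[%classic = (if x < y then (y - x)%:E else 0%E).
  by have := lebesgue_measure_itv `[x, y[; rewrite /= lte_fin -EFinB.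
have -> : mu X = m X.
  apply: (@lebesgue_measure_unique R m) => //.
  move=> _ [[c d] _ <-]; rewrite mE /=.
  have [a_gt0|a_lt0|/eqP] := ltrgt0P a; last by rewrite (negPf a0).
    rewrite [X in (_ * mu X)%E](_ : _ = `](c - b) / a, (d - b) / a]%classic); last first.
      apply/seteqP; split => x /=; rewrite !in_itv/= ltr_pdivrMr// ler_pdivlMr//;
        by rewrite ltrBlDr lerBrDr [a * _]mulrC.
    transitivity (if c < d then (d - c)%:E else 0%E); first exact: moc.
    have := moc ((c - b) / a) ((d - b) / a); move=> ->.
    rewrite ltr_pM2r ?invr_gt0// ltrD2r.
    case: ifPn => _; last by rewrite mule0.
    by rewrite -EFinM; congr EFin; field; exact: a0.
  rewrite [X in (_ * mu X)%E](_ : _ = `[(d - b) / a, (c - b) / a[%classic); last first.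
    apply/seteqP; split => x /=; rewrite !in_itv/= ltr_ndivlMr// ler_ndivrMr//;
      by rewrite lerBrDr ltrBlDr [a * _]mulrC andbC.
  transitivity (if c < d then (d - c)%:E else 0%E); first exact: moc.
  have := mco ((d - b) / a) ((c - b) / a); move=> ->.
  rewrite ltr_nM2r ?invr_lt0// ltrD2r.
  case: ifPn => _; last by rewrite mule0.
  by rewrite -EFinM; congr EFin; field; exact: a0.
by rewrite mE muleA -EFinM mulVf ?normr_eq0// mul1e.
Qed.

Lemma measurable_col_affine n p (A : 'M[R]_(p, n)) (b : 'cV[R]_p) :
  measurable_fun setT
    (fun t : n.-tuple mR => [tuple (A *m col_of_tuple t + b) i ord0 | i < p]
      : p.-tuple mR).
Proof.
apply/measurable_fun_tnthP => i.
rewrite (_ : _ \o _ =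
    (fun t : n.-tuple mR => (\sum_j A i j * tnth t j) + b i ord0 : mR)); last first.
  apply/funext => t /=; rewrite tnth_mktuple !mxE; congr (_ + _).
  by apply: eq_bigr => j _; rewrite mxE.
apply: measurable_realfun.measurable_funD => //.
apply: measurable_sum => j.
apply: measurable_realfun.measurable_funM => //; exact: measurable_tnth.
Qed.

Lemma meas_affine n p (A : 'M[R]_(p, n)) (b : 'cV[R]_p) X :
  meas X -> meas [set x | X (A *m x + b)].
Proof.
move=> mX; have := measurable_col_affine A b measurableT mX.
rewrite setTI; congr measurable; apply/seteqP; split => t;
rewrite /preimage /=; congr X;
by apply/matrixP => i j; rewrite !(mxE, tnth_mktuple, ord1).
Qed.

Lemma meas_linear n p (A : 'M[R]_(p, n)) X : meas X -> meas [set x | X (A *m x)].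
Proof. by move=> /(meas_affine A 0); under eq_set do rewrite addr0. Qed.

Lemma meas_translate n (b : 'cV[R]_n) X : meas X -> meas [set x | X (x + b)].
Proof. by move=> /(meas_affine 1%:M b); under eq_set do rewrite mul1mx. Qed.

End volume_theory.

(** * Invertible linear maps scale volume by the determinant *)

Section volume_linear.
Context {R : realType}.
Local Notation mR := (measurableTypeR R).
Local Notation mu := (@lebesgue_measure R).

Lemma col_of_tuple_cons n (x : mR) (t : n.-tuple mR) :
  col_of_tuple (tuple_cons (x, t)) =
    col_mx (x%:M : 'M[R]_1) (col_of_tuple t) :> 'cV[R]_(1 + n).
Proof.
apply/matrixP => i j; rewrite !mxE ord1; case: splitP => k ki.
  rewrite (_ : i = ord0); last by apply/val_inj; rewrite /= ki ord1.
  by rewrite !mxE !ord1 eqxx.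
rewrite (_ : i = lift ord0 k); last exact/val_inj.
by rewrite mxE tnthS; congr tnth; apply/val_inj.
Qed.

Lemma measurable_cons_preimage n (X : set 'cV[R]_(1 + n)) : meas X ->
  measurable [set p : mR * n.-tuple mR | X (col_mx (p.1%:M : 'M[R]_1) (col_of_tuple p.2))].
Proof.
move=> mX; have := @measurable_tuple_cons R n measurableT _ mX.
rewrite setTI; congr measurable; apply/funext => -[x t].
by rewrite /preimage/= col_of_tuple_cons.
Qed.

Lemma volumeS1 n (X : set 'cV[R]_(1 + n)) : meas X ->
  volume X = (\int[mu]_x volume [set y : 'cV[R]_n | X (col_mx (x%:M : 'M[R]_1) y)])%E.
Proof.
move=> mX; rewrite /volume /= /lebesgue_tupleS /pushforward /product_measure1.
apply: eq_integral => x _ /=; congr (lebesgue_tuple n _).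
by apply/funext => t; rewrite /xsection /= in_setE /= -col_of_tuple_cons.
Qed.

(** The other order of integration, from uniqueness of the product measure. It serves maps that move
    only the first coordinate, as [volumeS1] serves maps that fix it. *)
Lemma volumeS2 n (X : set 'cV[R]_(1 + n)) : meas X ->
  volume X = (\int[lebesgue_tuple n]_t
     mu [set x | X (col_mx (x%:M : 'M[R]_1) (col_of_tuple t))])%E.
Proof.
move=> mX; rewrite /volume /= /lebesgue_tupleS /pushforward.
have := measurable_cons_preimage mX; set Y := (Y in measurable Y) => mY.
transitivity ((mu \x (@lebesgue_tuple R n))%E Y).
  by congr (_ \x _)%E; apply/funext => -[x t]; rewrite /Y/= -col_of_tuple_cons.
have := @product_measure_unique _ _ _ _ R mu (lebesgue_tuple n)
  (product_measure2 mu (lebesgue_tuple n)).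
rewrite /= => ->//; last by move=> *; rewrite product_measure2E.
rewrite /product_measure2.
apply: eq_integral => t _ /=; congr (lebesgue_measure _).
by apply/funext => x; rewrite /ysection /= in_setE.
Qed.


Lemma volume_slice_map n (f : 'cV[R]_(1 + n) -> 'cV[R]_(1 + n))
    (g : R -> 'cV[R]_n -> 'cV[R]_n) (k : R) X : 0 <= k ->
  meas X -> meas [set p | X (f p)] ->
  (forall x y, f (col_mx x%:M y) = col_mx x%:M (g x y)) ->
  (forall x Y, meas Y -> volume [set y | Y (g x y)] = (k%:E * volume Y)%E) ->
  volume [set p | X (f p)] = (k%:E * volume X)%E.
Proof.
move=> k0 mX mfX fE gE; rewrite !volumeS1// -ge0_integralZl//.
- apply: eq_integral => x _.
  rewrite -(gE x [set y | X (col_mx (x%:M : 'M[R]_1) y)]); last first.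
    have := meas_affine (col_mx 0 1%:M : 'M[R]_(1 + n, n)) (col_mx (x%:M : 'M[R]_1) 0) mX.
    by under eq_set do rewrite mul_col_mx mul0mx mul1mx add_col_mx add0r addr0.
  by congr volume; apply/funext => y /=; rewrite fE.
- have := @measurable_fun_xsection _ _ _ _ _ (lebesgue_tuple n) _ (measurable_cons_preimage mX).
  congr measurable_fun; apply/funext => x /=; rewrite volumeE.
  by congr (lebesgue_tuple n _); apply/funext => t; rewrite /xsection /= in_setE.
Qed.

Lemma volume_fiber_map n (f : 'cV[R]_(1 + n) -> 'cV[R]_(1 + n))
    (a : R) (b : 'cV[R]_n -> R) X : a != 0 ->
  meas X -> meas [set p | X (f p)] ->
  (forall x y, f (col_mx x%:M y) = col_mx (a * x + b y)%:M y) ->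
  volume [set p | X (f p)] = (`|a|^-1%:E * volume X)%E.
Proof.
move=> a0 mX mfX fE; rewrite !volumeS2// -ge0_integralZl//.
- apply: eq_integral => t _.
  rewrite -(lebesgue_measure_affine (b (col_of_tuple t)))//; last first.
    have := measurable_ysection t (measurable_cons_preimage mX).
    by congr measurable; apply/funext => x; rewrite /ysection /= in_setE.
  by congr (lebesgue_measure _); apply/funext => x /=; rewrite fE.
- have := @measurable_fun_ysection _ _ _ _ _ mu _ (measurable_cons_preimage mX).
  congr measurable_fun; apply/funext => t /=.
  by congr (lebesgue_measure _); apply/funext => x; rewrite /ysection /= in_setE.
Qed.

Lemma volume_translate n (b : 'cV[R]_n) X : meas X ->
  volume [set x | X (x + b)] = volume X.
Proof.
elim: n => [|n IH] in b X *.
  by move=> _; congr volume; apply/funext => x /=; congr X; rewrite [LHS]flatmx0 [RHS]flatmx0.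
move=> mX; rewrite -(vsubmxK (b : 'cV[R]_(1 + n))).
set b0 := usubmx _; set b1 := dsubmx _.
have mY : meas [set x : 'cV[R]_(1 + n) | X (x + col_mx b0 0)].
  exact: (@meas_translate _ n.+1).
transitivity (volume [set x : 'cV[R]_(1 + n) | X (x + col_mx b0 0)]).
  set Y := [set x | _] in mY *.
  transitivity (1%:E * volume Y)%E; last by rewrite mul1e.
  transitivity (volume [set x : 'cV[R]_(1 + n) | Y (x + col_mx 0 b1)]).
    congr volume; apply/funext => x /=.
    by rewrite /Y/= -addrA add_col_mx addr0 add0r.
  apply: (volume_slice_map (g := fun _ y => y + b1)) => //.
  - exact: (@meas_translate _ n.+1 _ _ mY).
  - by move=> x y; rewrite add_col_mx addr0.
  - by move=> x Z mZ; rewrite IH// mul1e.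
rewrite (@volume_fiber_map n _ 1 (fun=> b0 ord0 ord0))//; last first.
  move=> x y; rewrite add_col_mx addr0 mul1r; congr col_mx.
  by rewrite [b0 in LHS]mx11_scalar raddfD.
by rewrite normr1 invr1 mul1e.
Qed.

Definition scales_volume n (A : 'M[R]_n) : Prop :=
  forall X, meas X -> volume [set x | X (A *m x)] = (`|\det A|^-1%:E * volume X)%E.

Lemma scales_volumeM n (A B : 'M[R]_n) :
  scales_volume A -> scales_volume B -> scales_volume (A *m B).
Proof.
move=> sA sB X mX; under eq_set do rewrite -mulmxA.
rewrite (sB [set y | X (A *m y)]); last exact: meas_linear.
by rewrite sA// muleA -EFinM det_mulmx normrM invfM [in RHS]mulrC.
Qed.

Lemma scales_volume_lower n (c : 'M[R]_(n, 1)) (D : 'M[R]_n) :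
  scales_volume D -> scales_volume (block_mx 1%:M 0 c D : 'M[R]_(1 + n)).
Proof.
move=> sD X mX.
rewrite det_lblock det1 mul1r.
apply: (@volume_slice_map n _ (fun x y => D *m y + c *m x%:M)) => //.
- exact: (meas_linear _ mX).
- move=> x y; rewrite mul_block_col mul1mx mul0mx addr0; congr col_mx.
  by rewrite addrC.
- move=> x Y mY; rewrite (sD [set y | Y (y + c *m x%:M)]); last exact: meas_translate.
  by rewrite volume_translate.
Qed.

Lemma scales_volume_upper n (a : R) (b : 'M[R]_(1, n)) : a != 0 ->
  scales_volume (block_mx (a%:M : 'M[R]_1) b 0 1%:M : 'M[R]_(1 + n)).
Proof.
move=> a0 X mX.
rewrite det_ublock det1 mulr1 det_scalar1.
apply: (@volume_fiber_map n _ a (fun y => (b *m y) ord0 ord0)) => //.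
- exact: (meas_linear _ mX).
- move=> x y; rewrite mul_block_col mul1mx mul0mx add0r; congr col_mx.
  by rewrite -scalar_mxM [b *m y in LHS]mx11_scalar -raddfD.
Qed.

(* Block elimination with a nonzero upper left entry, which a transvection
   provides when the entry is zero. *)
Lemma scales_volume_unit n (A : 'M[R]_n) : A \in unitmx -> scales_volume A.
Proof.
elim: n => [|n IH] in A *.
  move=> _ X mX; rewrite det_mx00 normr1 invr1 mul1e; congr volume.
  by apply/funext => x /=; congr X; rewrite [LHS]flatmx0 [RHS]flatmx0.
have pivot (B : 'M[R]_(1 + n)) : B \in unitmx -> B ord0 ord0 != 0 -> scales_volume B.
  move=> uB b0; pose a := B ord0 ord0.
  have ulE : ulsubmx B = a%:M.
    rewrite [LHS]mx11_scalar !mxE; congr (B _ _)%:M; exact/val_inj.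
  pose S := drsubmx B - a^-1 *: (dlsubmx B *m ursubmx B).
  have BE : B = block_mx 1%:M 0 (a^-1 *: dlsubmx B) S *m
      block_mx a%:M (ursubmx B) 0 1%:M.
    rewrite mulmx_block !mul0mx !mul1mx !mulmx1 mulmx0 !addr0.
    rewrite mul_mx_scalar scalerA divff// scale1r -scalemxAl /S addrC subrK -ulE.
    by rewrite submxK.
  have uS : S \in unitmx.
    move: uB; rewrite BE unitmx_mul => /andP[+ _].
    by rewrite !unitmxE det_lblock det1 mul1r.
  rewrite BE; apply: scales_volumeM.
    exact/scales_volume_lower/IH.
  exact: scales_volume_upper.
move=> uA; have [a0|/pivot] := eqVneq (A ord0 ord0) 0; last exact.
have [k Ak] : exists k : 'I_n, A (lift ord0 k) ord0 != 0.
  apply/existsP; apply: contraT; rewrite negb_exists => /forallP Z.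
  have : \det A = 0.
    rewrite (expand_det_col A ord0) big1// => i _.
    have [->|] := eqVneq i ord0; first by rewrite a0 mul0r.
    rewrite eq_sym => /unlift_some[j -> _].
    by have := Z j; rewrite negbK => /eqP ->; rewrite mul0r.
  by move/eqP; move: uA; rewrite unitmxE unitfE => /negPf ->.
(* [T s] adds [s] times row [lift ord0 k] to the first row, so the nonzero entry found above becomes
   the pivot of [T 1 *m A]; [T (-1)] undoes this. *)
pose T (s : R) : 'M[R]_(1 + n) := block_mx (1%:M : 'M[R]_1) (s *: delta_mx ord0 k) 0 1%:M.
have TT : T (-1) *m T 1 = 1%:M.
  rewrite mulmx_block !mul0mx !mulmx0 !mul1mx !mulmx1 !addr0 add0r scaleN1r scale1r.
  by rewrite subrr -scalar_mx_block.
have uT s : T s \in unitmx by rewrite unitmxE det_ublock !det1 mulr1 unitr1.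
have sT s : scales_volume (T s) by apply: scales_volume_upper; exact: oner_neq0.
rewrite -[A]mul1mx -TT -mulmxA; apply: scales_volumeM => //.
apply: pivot; first by rewrite unitmx_mul uT.
rewrite mxE /T (@big_split_ord _ _ _ 1 n) /= big_ord1 (bigD1 k)//= big1 ?addr0.
  have E0 : @ord0 n = lshift n (@ord0 0) by exact/val_inj.
  have Ek : lift ord0 k = rshift 1 k by exact/val_inj.
  rewrite {1 3}E0.
  rewrite (@block_mxEul _ 1 n 1 n) (@block_mxEur _ 1 n 1 n) -E0 -Ek a0.
  by rewrite !mxE !eqxx mulr0 add0r !mul1r.
move=> j jk; have E0 : @ord0 n = lshift n (@ord0 0) by exact/val_inj.
by rewrite {1}E0 (@block_mxEur _ 1 n 1 n) !mxE (negPf jk) mulr0 mul0r.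
Qed.

Lemma volume_affine n (A : 'M[R]_n) b X : A \in unitmx -> meas X ->
  volume [set x | X (A *m x + b)] = (`|\det A|^-1%:E * volume X)%E.
Proof.
move=> uA mX; rewrite (scales_volume_unit uA (X := [set x | X (x + b)])).
  by rewrite volume_translate.
exact: meas_translate.
Qed.

End volume_linear.

(** * Cubes, closed sets and subadditivity *)

Section volume_sets.
Context {R : realType}.
Local Notation mR := (measurableTypeR R).
Local Notation mu := (@lebesgue_measure R).

Definition cube n (z : 'cV[R]_n) (s : R) : set 'cV[R]_n :=
  [set x | forall i, z i ord0 <= x i ord0 <= z i ord0 + s].

Lemma meas_cube n (z : 'cV[R]_n) s : meas (cube z s).
Proof.
rewrite /meas (_ : _ @^-1` _ = \bigcap_(i in [set: 'I_n])
   ((fun t : n.-tuple mR => tnth t i) @^-1` `[z i ord0, z i ord0 + s])).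
  apply: fin_bigcap_measurable => // i _.
  rewrite -[X in measurable X]setTI.
  exact: (@measurable_tnth _ mR n i measurableT _ (measurable_itv _)).
apply/seteqP; split => t.
  by move=> + i _; move/(_ i); rewrite mxE /= in_itv.
by move=> + i; move/(_ i Logic.I); rewrite /= mxE in_itv.
Qed.

Lemma volume_cube n (z : 'cV[R]_n) s : 0 <= s -> volume (cube z s) = (s ^+ n)%:E.
Proof.
move=> s0; elim: n z => [|n IH] z.
  rewrite expr0 volumeE /= /lebesgue_tuple0 diracE.
  by rewrite mem_set//= => -[].
rewrite volumeE /= /lebesgue_tupleS /pushforward.
rewrite (_ : tuple_cons (n:=n) @^-1` _ =
  `[z ord0 ord0, z ord0 ord0 + s]%classic `*`
   (@col_of_tuple R n @^-1` cube (dsubmx (z : 'cV_(1 + n))) s)).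
  rewrite product_measure1E//; last exact: meas_cube.
  rewrite exprS EFinM; congr (_ * _)%E; last exact: IH.
  have := lebesgue_measure_itv `[z ord0 ord0, z ord0 ord0 + s].
  rewrite /= lte_fin ltrDl => ->; case: ifPn => [_|].
    by rewrite -EFinB addrAC subrr add0r.
  by rewrite -leNgt => s1; congr EFin; apply/eqP; rewrite eq_le s0 s1.
apply/seteqP; split => -[x t] /=.
  move=> H; split.
    by have := H ord0; rewrite mxE (tnth_nth 0)/= in_itv.
  move=> i; have := H (lift ord0 i).
  rewrite !mxE tnthS (_ : rshift 1 i = lift ord0 i); last exact: val_inj.
  by rewrite (_ : tnth _ _ = tnth t i)//; congr tnth; exact: val_inj.
move=> [Hx Ht] i; have [->|] := eqVneq i ord0.
  by move: Hx; rewrite /= in_itv/= mxE (tnth_nth 0).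
rewrite eq_sym => /unlift_some[j -> _].
have := Ht j; rewrite !mxE tnthS (_ : rshift 1 j = lift ord0 j); last exact: val_inj.
by rewrite (_ : tnth _ _ = tnth t j)//; congr tnth; exact: val_inj.
Qed.

Lemma meas_bigcup_countable n (I : countType) (P : set I) (F : I -> set 'cV[R]_n) :
  (forall i, meas (F i)) -> meas (\bigcup_(i in P) F i).
Proof.
move=> mF; rewrite /meas (_ : _ @^-1` _ = \bigcup_(k in [set: nat])
   (if unpickle k is Some i then
     if `[< P i >] then @col_of_tuple R n @^-1` F i else set0 else set0)).
  apply: bigcupT_measurable => k; case: unpickle => // i.
  by case: ifP => // _; exact: mF.
apply/seteqP; split => t.
  by move=> [i Pi Fi]; exists (pickle i) => //; rewrite pickleK; case: asboolP.
by move=> [k _]; case: unpickle => // i; case: asboolP => // Pi Fi; exists i.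
Qed.

Lemma meas_bigcap n (F : nat -> set 'cV[R]_n) :
  (forall i, meas (F i)) -> meas (\bigcap_i F i).
Proof.
move=> mF; rewrite /meas (_ : _ @^-1` _ = \bigcap_k (@col_of_tuple R n @^-1` F k)) //.
by apply: bigcap_measurableType => k _; exact: mF.
Qed.

Lemma in_grid_cube n (x : 'cV[R]_n) (d : R) : 0 < d ->
  cube (\col_i (d * (Num.floor (x i ord0 / d))%:~R)) d x.
Proof.
move=> d0 i; rewrite mxE -ler_pdivlMl// [d^-1 * _]mulrC floor_le/=.
have /ltW := floorD1_gt (x i ord0 / d).
by rewrite ler_pdivrMr// rmorphD /= mulrDl mul1r [d * _]mulrC.
Qed.

(** A closed set is the intersection over [m] of the unions of those grid cubes of side [d m] that
    meet it: a point in all these unions has points of [X] arbitrarily near. Each union is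
    countable, its cubes being indexed by integer vectors. *)
Lemma closed_meas n (X : set 'cV[R]_n) : closed X -> meas X.
Proof.
move=> cX; pose d (m : nat) : R := m.+1%:R^-1.
have d0 m : 0 < d m by rewrite invr_gt0.
pose z m (k : {ffun 'I_n -> int}) : 'cV[R]_n := \col_i (d m * (k i)%:~R).
rewrite (_ : X = \bigcap_m \bigcup_(k in [set k | cube (z m k) (d m) `&` X !=set0])
   cube (z m k) (d m)).
  by apply: meas_bigcap => m; apply: meas_bigcup_countable => k; exact: meas_cube.
apply/seteqP; split => x.
  move=> Xx m _; exists [ffun i => Num.floor (x i ord0 / d m)].
    exists x; split => //.
    by rewrite (_ : z m _ = (\col_i (d m * (Num.floor (x i ord0 / d m))%:~R)));
      [exact: in_grid_cube | apply/colP => i; rewrite !mxE ffunE].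
  by rewrite (_ : z m _ = (\col_i (d m * (Num.floor (x i ord0 / d m))%:~R)));
      [exact: in_grid_cube | apply/colP => i; rewrite !mxE ffunE].
move=> Hx; move/closure_id: cX => ->; move=> B /nbhs_ballP[e /= e0 Be].
have [m] := ltr_add_invr e0; rewrite add0r => me.
have [k [y [yc Xy]] xc] := Hx m Logic.I.
exists y; split => //; apply: Be; rewrite mx_norm_ball /ball_/=.
rewrite [ltLHS]mx_normrE; apply/bigmax_ltP; split => // -[i j] _ /=.
rewrite ord1 !mxE; apply: le_lt_trans me.
have := yc i; have := xc i; rewrite -/(d m).
by rewrite !mxE ler_norml => /andP[? ?] /andP[? ?]; apply/andP; split; lra.
Qed.

Lemma le_volume n (X Y : set 'cV[R]_n) : meas X -> meas Y -> X `<=` Y ->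
  (volume X <= volume Y)%E.
Proof.
by move=> mX mY XY; rewrite !volumeE le_measure// ?inE// => t; exact: XY.
Qed.

Lemma volume_ge0 n (X : set 'cV[R]_n) : (0 <= volume X)%E.
Proof. by rewrite volumeE. Qed.

Lemma volume_sub_sum n (I : finType) (P : pred I) (F : I -> set 'cV[R]_n) X :
  meas X -> (forall i, P i -> meas (F i)) -> X `<=` \bigcup_(i in P) F i ->
  (volume X <= \sum_(i | P i) volume (F i))%E.
Proof.
move=> mX mF XF; rewrite volumeE.
have := @content_sub_fsum _ _ _ (lebesgue_tuple n) I [set` P]
  (@col_of_tuple R n @^-1` X) (fun i => @col_of_tuple R n @^-1` F i).
rewrite -(bigfs _ (index_enum_uniq I)) //; last by move=> i _; rewrite mem_index_enum.
by apply => // t /XF[i Pi Fi]; exists i.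
Qed.

Lemma volumeU_disj n (X Y : set 'cV[R]_n) : meas X -> meas Y ->
  X `&` Y = set0 -> volume (X `|` Y) = (volume X + volume Y)%E.
Proof.
move=> mX mY XY; rewrite !volumeE preimage_setU measureU//.
by rewrite -preimage_setI XY preimage_set0.
Qed.

End volume_sets.

(** * Determinants of weighted frames *)

(** With [s = 1] this is the sum in John's decomposition; with [s i] the slope of T at the i-th slab
    coordinate it is the derivative of Theta. *)
Definition frame_mx (R : realType) n N (c : 'I_N -> R) (u : 'I_N -> 'cV[R]_n)
    (s : 'I_N -> R) : 'M[R]_n :=
  \sum_i (c i * s i) *: (u i *m (u i)^T).

Section spectral_weights.
Local Open Scope complex_scope.
Local Open Scope sesquilinear_scope.
Context {R : realType}.
Local Notation C := R[i].
Local Notation rc := (real_complex R).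

Definition sqnormc (z : C) : R := complex.Re z ^+ 2 + complex.Im z ^+ 2.

Lemma sqnormcE (z : C) : (sqnormc z)%:C = z * Num.conj z.
Proof.
rewrite -normCK normc_def -rmorphXn /= sqr_sqrtr //.
by rewrite addr_ge0// sqr_ge0.
Qed.

Lemma sqnormc_ge0 z : 0 <= sqnormc z.
Proof. by rewrite addr_ge0// sqr_ge0. Qed.

Lemma sqnormc_eq0 z : sqnormc z = 0 -> z = 0.
Proof.
move=> z0; apply/eqP; rewrite -normr_eq0 -sqrf_eq0 normCK -sqnormcE z0.
by [].
Qed.

Lemma conjC_rc (x : R) : Num.conj (x%:C) = x%:C.
Proof. by apply/CrealP; rewrite complex_real. Qed.

(* The weights are [c i * |<u i, e_k>|^2] for a unitary eigenbasis [e_k] of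
   [frame_mx c u s], diagonalized over R[i]. *)
Lemma frame_spectral_weights n N (c : 'I_N -> R) (u : 'I_N -> 'cV[R]_n) (s : 'I_N -> R) :
  (forall i, 0 <= c i) -> (forall i, dotv (u i) (u i) = 1) ->
  frame_mx c u (fun=> 1) = 1%:M ->
  exists w : 'I_N -> 'I_n -> R,
    [/\ forall i k, 0 <= w i k,
        forall k, \sum_i w i k = 1,
        forall i, \sum_k w i k = c i,
        \det (frame_mx c u s) = \prod_k \sum_i w i k * s i &
        forall i j, 0 < c i -> 0 < c j -> dotv (u i) (u j) != 0 ->
          exists k, 0 < w i k /\ 0 < w j k].
Proof.
move=> c0 u1 cu1.
pose Sc s := map_mx rc (frame_mx c u s).
pose P := spectralmx (Sc s).
have Pu : P \is unitarymx := spectral_unitarymx _.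
pose z i : 'cV[C]_n := P *m map_mx rc (u i).
have ScE t : P *m Sc t *m P^t* =
    \sum_i (c i * t i)%:C *: (z i *m (z i)^t*).
  rewrite /Sc /frame_mx raddf_sum /= mulmx_sumr mulmx_suml.
  apply: eq_bigr => i _.
  rewrite map_mxZ -scalemxAr -scalemxAl; congr (_ *: _).
  rewrite map_mxM /z trmx_mul map_mxM -!mulmxA; congr (_ *m (_ *m (_ *m _))).
  by apply/matrixP => k l; rewrite !mxE /= conjC_rc.
have SH t : Sc t \is hermsymmx.
  apply/is_hermitianmxP; rewrite expr0 scale1r; apply/matrixP => i j.
  rewrite !mxE conjC_rc /frame_mx !summxE; congr (_%:C); apply: eq_bigr => k _.
  by rewrite !mxE !big_ord1 !mxE [u k i _ * _]mulrC.
have dE : P *m Sc s *m P^t* = diag_mx (spectral_diag (Sc s)).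
  have /hermitian_normalmx/orthomx_spectralP E := SH s.
  rewrite {1}E -/P invmx_unitary// !mulmxA (unitarymxP Pu) mul1mx.
  by rewrite -mulmxA (unitarymxP Pu) mulmx1.
exists (fun i k => c i * sqnormc (z i k ord0)).
have ent t k : (\sum_i (c i * t i)%:C *: (z i *m (z i)^t*)) k k =
    (\sum_i c i * sqnormc (z i k ord0) * t i)%:C.
  rewrite summxE raddf_sum; apply: eq_bigr => i _.
  rewrite !mxE big_ord1 !mxE -sqnormcE /= -rmorphM /=; congr (_%:C).
  by rewrite mulrAC.
(* The unitary [P] preserves scalar products. For [i = j] this yields the total weight [c i]; for
   [u i] and [u j] not orthogonal it forces a coordinate where both are nonzero. *)
have zz i j : ((z i)^t* *m z j) ord0 ord0 = (dotv (u i) (u j))%:C.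
  rewrite /z trmx_mul map_mxM !mulmxA -[_ *m P^t* *m P]mulmxA.
  rewrite -[in P^t* *m P]invmx_unitary// mulVmx ?unitarymx_unit// mulmx1.
  rewrite /dotv [LHS]mxE [in RHS]mxE raddf_sum; apply: eq_bigr => k _.
  by rewrite !mxE /= conjC_rc -rmorphM.
split.
- by move=> i k; rewrite mulr_ge0// sqnormc_ge0.
- move=> k; apply: (@complexI R).
  have := ent (fun=> 1) k; rewrite -ScE /Sc cu1 map_mx1 mulmx1 (unitarymxP Pu).
  rewrite mxE eqxx (rmorph1 rc) => E; rewrite -[1]/(true%:R : C) E; congr (_%:C).
  by apply: eq_bigr => i _; rewrite mulr1.
- move=> i; rewrite -mulr_sumr -[RHS]mulr1; congr (_ * _).
  apply: (@complexI R); rewrite -(u1 i) -zz mxE raddf_sum.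
  by apply: eq_bigr => k _; rewrite !mxE [RHS]mulrC -sqnormcE.
- apply: (@complexI R); rewrite -det_map_mx -/(Sc s).
  transitivity (\det (P *m Sc s *m P^t*)).
    rewrite !det_mulmx mulrAC -det_mulmx (unitarymxP Pu) det1 mul1r //.
  rewrite dE det_diag rmorph_prod; apply: eq_bigr => k _.
  by have := ent s k; rewrite -ScE dE mxE eqxx mulr1n.
- move=> i j ci cj uij.
  have [k] : exists k : 'I_n, Num.conj (z i k ord0) * z j k ord0 != 0.
    apply/existsP; apply: contraT; rewrite negb_exists => /forallP H.
    have /eqP := zz i j; rewrite mxE big1 => [|k _].
      by rewrite eq_sym (fmorph_eq0 rc) (negPf uij).
    by have := H k; rewrite negbK => /eqP <-; congr (_ * _); rewrite 2!mxE.
  rewrite mulf_eq0 conjC_eq0 negb_or => /andP[zi zj].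
  have pos v : v != 0 -> 0 < sqnormc v.
    move=> v0; rewrite lt_def sqnormc_ge0 andbT; apply: contra v0 => /eqP.
    by move=> /sqnormc_eq0 ->.
  by exists k; split; [exact: mulr_gt0 ci (pos _ zi)|exact: mulr_gt0 cj (pos _ zj)].
Qed.

End spectral_weights.

Section frame_det.
Context {R : realType}.

Lemma ln_le_tangent (s t : R) : 0 < s -> 0 < t -> ln t <= ln s + (t / s - 1).
Proof.
move=> s0 t0.
have ts0 : 0 < t / s by rewrite divr_gt0.
rewrite -{1}(divfK (lt0r_neq0 s0) t) lnM ?posrE// addrC lerD2l.
rewrite -{1}(subrKC 1 (t / s)); by apply: le_ln1Dx; rewrite ltrBrDr addNr.
Qed.

(* Apply the tangent inequality to the square roots. *)
Lemma ln_lt_tangent (s t : R) : 0 < s -> 0 < t -> t != s ->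
  ln t < ln s + (t / s - 1).
Proof.
move=> s0 t0 ts.
have ts0 : 0 < t / s by rewrite divr_gt0.
rewrite -{1}(divfK (lt0r_neq0 s0) t) lnM ?posrE// addrC ltrD2l.
set x := t / s in ts0 *; have x1 : x != 1.
  by apply: contra ts => /eqP x1; rewrite -(divfK (lt0r_neq0 s0) t) -/x x1 mul1r.
have r0 : 0 < Num.sqrt x by rewrite sqrtr_gt0.
have xE : x = Num.sqrt x ^+ 2 by rewrite sqr_sqrtr// ltW.
have r1 : Num.sqrt x - 1 != 0.
  by apply: contra x1; rewrite subr_eq0 => /eqP r1; rewrite xE r1 expr1n.
have := @ln_le_tangent 1 (Num.sqrt x) ltr01 r0.
rewrite ln1 add0r divr1 => H.
have -> : ln x = ln (Num.sqrt x) + ln (Num.sqrt x) by rewrite {1}xE lnXn// mulr2n.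
have : 0 < (Num.sqrt x - 1) ^+ 2 by rewrite exprn_even_gt0//= r1.
by rewrite [X in _ < X - 1]xE; nra.
Qed.

Lemma ln_prod (I : Type) (r : seq I) (f : I -> R) : (forall i, 0 < f i) ->
  ln (\prod_(i <- r) f i) = \sum_(i <- r) ln (f i).
Proof.
move=> f0; elim: r => [|i r IH]; first by rewrite !big_nil ln1.
by rewrite !big_cons lnM ?posrE ?prodr_gt0// IH.
Qed.

Lemma weighted_mean_gt0 N (w s : 'I_N -> R) : (forall i, 0 <= w i) ->
  \sum_i w i = 1 -> (forall i, 0 < s i) -> 0 < \sum_i w i * s i.
Proof.
move=> w0 w1 s0; rewrite lt_def sumr_ge0 ?andbT => [|i _]; last first.
  by rewrite mulr_ge0// ltW.
rewrite psumr_eq0 => [|i _]; last by rewrite mulr_ge0// ltW.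
apply/negP => /allP H; have /eqP := oner_neq0 R; apply.
rewrite -w1 big1// => i _; have := H i (mem_index_enum _) => /=.
by rewrite mulf_eq0 (gt_eqF (s0 i)) orbF => /eqP.
Qed.

Lemma ln_weighted_mean N (w s : 'I_N -> R) : (forall i, 0 <= w i) ->
  \sum_i w i = 1 -> (forall i, 0 < s i) ->
  \sum_i w i * ln (s i) <= ln (\sum_i w i * s i).
Proof.
move=> w0 w1 s0; have S0 := weighted_mean_gt0 w0 w1 s0; set S := \sum_i _ in S0 *.
apply: (@le_trans _ _ (\sum_i w i * (ln S + (s i / S - 1)))).
  by apply: ler_sum => i _; rewrite ler_wpM2l// ln_le_tangent.
under eq_bigr do rewrite mulrDr mulrBr mulr1 mulrA.
rewrite big_split sumrB /= -!mulr_suml w1 mul1r -/S divff ?gt_eqF//.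
by rewrite subrr addr0.
Qed.

Lemma ln_weighted_mean_lt N (w s : 'I_N -> R) i j : (forall i, 0 <= w i) ->
  \sum_i w i = 1 -> (forall i, 0 < s i) ->
  0 < w i -> 0 < w j -> s i != s j ->
  \sum_i w i * ln (s i) < ln (\sum_i w i * s i).
Proof.
move=> w0 w1 s0 wi wj sij.
have S0 := weighted_mean_gt0 w0 w1 s0; set S := \sum_i _ in S0 *.
have [k wk sk] : exists2 k, 0 < w k & s k != S.
  have [siS|] := eqVneq (s i) S; last by exists i.
  by exists j => //; rewrite -siS eq_sym.
apply: (@lt_le_trans _ _ (\sum_i w i * (ln S + (s i / S - 1)))).
  rewrite (bigD1 k)//= [ltRHS](bigD1 k)//=; apply: ltr_leD.
    by rewrite ltr_pM2l// ln_lt_tangent.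
  by apply: ler_sum => l _; rewrite ler_wpM2l// ln_le_tangent.
under eq_bigr do rewrite mulrDr mulrBr mulr1 mulrA.
rewrite big_split sumrB /= -!mulr_suml w1 mul1r -/S divff ?gt_eqF//.
by rewrite subrr addr0.
Qed.

Variables (n N : nat) (c : 'I_N -> R) (u : 'I_N -> 'cV[R]_n) (s : 'I_N -> R).
Hypotheses (c0 : forall i, 0 <= c i) (u1 : forall i, dotv (u i) (u i) = 1).
Hypotheses (cu1 : frame_mx c u (fun=> 1) = 1%:M) (s0 : forall i, 0 < s i).

Lemma frame_det_gt0 : 0 < \det (frame_mx c u s).
Proof.
have [w [w0 w1 _ -> _]] := frame_spectral_weights s c0 u1 cu1.
by apply: prodr_gt0 => k _; apply: weighted_mean_gt0.
Qed.

(** Jensen's inequality for each eigenvalue, a mean of the [s i] with weights [w i k]; summing over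
    [k] collects the total weights [c i]. *)
Lemma ln_frame_det : \sum_i c i * ln (s i) <= ln (\det (frame_mx c u s)).
Proof.
have [w [w0 w1 wc -> _]] := frame_spectral_weights s c0 u1 cu1.
rewrite ln_prod => [|k]; last exact: weighted_mean_gt0.
under eq_bigr do rewrite -wc mulr_suml.
by rewrite exchange_big; apply: ler_sum => k _; exact: ln_weighted_mean.
Qed.

(** Directions that are not orthogonal both have positive weight at a common eigenvector, and there
    Jensen's inequality is strict. *)
Lemma ln_frame_det_lt i j : 0 < c i -> 0 < c j -> dotv (u i) (u j) != 0 ->
  s i != s j -> \sum_i c i * ln (s i) < ln (\det (frame_mx c u s)).
Proof.
move=> ci cj uij sij.
have [w [w0 w1 wc -> /(_ i j ci cj uij)[k [wik wjk]]]] :=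
  frame_spectral_weights s c0 u1 cu1.
rewrite ln_prod => [|l]; last exact: weighted_mean_gt0.
under eq_bigr do rewrite -wc mulr_suml.
rewrite exchange_big (bigD1 k)//= [ltRHS](bigD1 k)//=; apply: ltr_leD.
  exact: (ln_weighted_mean_lt (i := i) (j := j)).
by apply: ler_sum => l _; exact: ln_weighted_mean.
Qed.

End frame_det.

(** * Scalar products and decompositions of the identity *)

Section dot_product.
Context {R : realType} {n : nat}.
Implicit Types x y z u : 'cV[R]_n.

Lemma dotvE x y : dotv x y = \sum_i x i ord0 * y i ord0.
Proof. by rewrite /dotv mxE; apply: eq_bigr => i _; rewrite mxE. Qed.

Lemma dotvC x y : dotv x y = dotv y x.
Proof. by rewrite !dotvE; apply: eq_bigr => i _; rewrite mulrC. Qed.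

Lemma dotvDl x y z : dotv (x + y) z = dotv x z + dotv y z.
Proof. by rewrite /dotv linearD mulmxDl mxE. Qed.

Lemma dotvDr x y z : dotv z (x + y) = dotv z x + dotv z y.
Proof. by rewrite /dotv mulmxDr mxE. Qed.

Lemma dotvZl a x y : dotv (a *: x) y = a * dotv x y.
Proof. by rewrite /dotv linearZ -scalemxAl mxE. Qed.

Lemma dotvZr a x y : dotv y (a *: x) = a * dotv y x.
Proof. by rewrite /dotv -scalemxAr mxE. Qed.

Lemma dotvNl x y : dotv (- x) y = - dotv x y.
Proof. by rewrite -scaleN1r dotvZl mulN1r. Qed.

Lemma dotvNr x y : dotv y (- x) = - dotv y x.
Proof. by rewrite -scaleN1r dotvZr mulN1r. Qed.

Lemma dotvBl x y z : dotv (x - y) z = dotv x z - dotv y z.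
Proof. by rewrite dotvDl dotvNl. Qed.

Lemma dotvBr x y z : dotv z (x - y) = dotv z x - dotv z y.
Proof. by rewrite dotvDr dotvNr. Qed.

Lemma dotv0l x : dotv 0 x = 0.
Proof. by rewrite -(scale0r x) dotvZl mul0r. Qed.

Lemma dotv0r x : dotv x 0 = 0.
Proof. by rewrite dotvC dotv0l. Qed.

Lemma dotv_suml (I : finType) (F : I -> 'cV[R]_n) y :
  dotv (\sum_i F i) y = \sum_i dotv (F i) y.
Proof.
by elim/big_ind2: _ => [|a b d e <- <-|]; rewrite ?dotv0l ?dotvDl.
Qed.

Lemma dotv_ge0 x : 0 <= dotv x x.
Proof. by rewrite dotvE sumr_ge0// => i _; rewrite -expr2 sqr_ge0. Qed.

Lemma sqr_coord_le_dotv x i : x i ord0 ^+ 2 <= dotv x x.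
Proof.
rewrite dotvE (bigD1 i)//= -expr2 lerDl sumr_ge0// => j _.
by rewrite -expr2 sqr_ge0.
Qed.

Lemma dotv_eq0 x : (dotv x x == 0) = (x == 0).
Proof.
apply/idP/idP => [/eqP x0|/eqP ->]; last by rewrite dotv0l.
apply/eqP/colP => i; rewrite mxE; apply/eqP.
by rewrite -sqrf_eq0 eq_le sqr_ge0 -x0 sqr_coord_le_dotv.
Qed.

Lemma dotv_mulmx (A : 'M[R]_n) x y : dotv (A *m x) y = dotv x (A^T *m y).
Proof. by rewrite /dotv trmx_mul mulmxA. Qed.

Lemma dotv_CS x y : dotv x y ^+ 2 <= dotv x x * dotv y y.
Proof.
have [->|y0] := eqVneq y 0; first by rewrite !dotv0r mulr0 expr0n.
have yy : 0 < dotv y y by rewrite lt_def dotv_ge0 dotv_eq0 y0.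
have := dotv_ge0 (dotv y y *: x - dotv x y *: y).
rewrite !(dotvBl, dotvBr, dotvZl, dotvZr) (dotvC y x).
set a := dotv x x; set b := dotv x y; set d := dotv y y in yy *.
rewrite [X in 0 <= X](_ : _ = d * (a * d - b ^+ 2)); last by ring.
by rewrite pmulr_rge0// subr_ge0.
Qed.

End dot_product.

Section frame_dot.
Context {R : realType} {n N : nat}.
Variables (c : 'I_N -> R) (u : 'I_N -> 'cV[R]_n).

Lemma frame_mx_mul s x :
  frame_mx c u s *m x = \sum_i (c i * s i * dotv (u i) x) *: u i.
Proof.
rewrite /frame_mx mulmx_suml; apply: eq_bigr => i _.
rewrite -scalemxAl -mulmxA [(u i)^T *m x]mx11_scalar mul_mx_scalar scalerA.
by rewrite -/(dotv (u i) x).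
Qed.

Hypothesis cu1 : frame_mx c u (fun=> 1) = 1%:M.

Lemma frame_expand x : x = \sum_i (c i * dotv (u i) x) *: u i.
Proof.
rewrite -[LHS]mul1mx -cu1 frame_mx_mul.
by apply: eq_bigr => i _; rewrite mulr1.
Qed.

Lemma frame_parseval x y : \sum_i c i * (dotv (u i) x * dotv (u i) y) = dotv x y.
Proof.
rewrite {2}(frame_expand x) dotv_suml; apply: eq_bigr => i _.
by rewrite dotvZl mulrA.
Qed.

Lemma frame_trace : (forall i, dotv (u i) (u i) = 1) -> \sum_i c i = n%:R.
Proof.
move=> u1; rewrite -(mxtrace1 R n) -cu1 /frame_mx raddf_sum; apply: eq_bigr => i _.
rewrite /= mxtraceZ mxtrace_mulC mulr1 /mxtrace big_ord1 -/(dotv (u i) (u i)).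
by rewrite u1 mulr1.
Qed.

(* The coefficients [t] need not be the canonical ones [dotv (u i) z], which
   minimize the weighted square sum. *)
Lemma frame_norm_le t : (forall i, 0 <= c i) ->
  dotv (\sum_i (c i * t i) *: u i) (\sum_i (c i * t i) *: u i) <=
  \sum_i c i * t i ^+ 2.
Proof.
move=> c0; set z := \sum_i _.
have zz : \sum_i c i * (t i * dotv (u i) z) = dotv z z.
  by rewrite {2}/z dotv_suml; apply: eq_bigr => i _; rewrite dotvZl mulrA.
have : 0 <= \sum_i c i * (t i - dotv (u i) z) ^+ 2.
  by apply: sumr_ge0 => i _; rewrite mulr_ge0// sqr_ge0.
under eq_bigr do rewrite sqrrB mulrDr mulrBr mulr2n mulrDr.
rewrite big_split sumrB big_split /= zz.
under [X in _ <= _ + X]eq_bigr do rewrite expr2.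
by rewrite frame_parseval; lra.
Qed.

End frame_dot.

(** * The Gaussian distribution function *)

Section gaussian.
Context {R : realType}.
Local Notation mu := (@lebesgue_measure R).

Definition gauss (t : R) : R := normal_pdf 0 1 t.
Definition gauss_peak : R := normal_peak 1.
Definition gauss_cdf (x : R) : R := (\int[mu]_(t in `]-oo, x]) gauss t)%R.

Lemma gauss_peak_gt0 : 0 < gauss_peak.
Proof. exact/normal_peak_gt0/oner_neq0. Qed.

Lemma gaussE t : gauss t = gauss_peak * expR (- (t ^+ 2 / 2)).
Proof.
rewrite /gauss normal_pdfE ?oner_neq0// /normal_fun subr0 expr1n.
by rewrite mulNr mulr2n.
Qed.

Lemma gauss_gt0 t : 0 < gauss t.
Proof. by rewrite gaussE mulr_gt0 ?gauss_peak_gt0 ?expR_gt0. Qed.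

Lemma gauss_le_peak t : gauss t <= gauss_peak.
Proof. exact/normal_pdf_ub/oner_neq0. Qed.

Lemma is_derive_gauss (t : R) : is_derive t (1 : R) gauss (- t * gauss t).
Proof.
have H : is_derive t (1 : R) (fun x : R => - (2^-1 * x ^+ 2)) (- t).
  by apply: is_derive_eq; rewrite /GRing.scale/=; field.
have D : is_derive t (1 : R)
    (gauss_peak *: (expR \o (fun x : R => - (2^-1 * x ^+ 2))))
    (- t * gauss t).
  by apply: is_derive_eq; rewrite gaussE /GRing.scale /= ?[2^-1 * _ ^+ 2]mulrC //; field.
move: D; set F := (X in is_derive _ _ X _) => D.
have E : F = gauss by apply/funext => s; rewrite gaussE [_ / 2]mulrC.
by move: D; rewrite E.
Qed.

(** The derivative is [- x * gauss x], and |x| <= 1 + x^2/2 <= exp(x^2/2) bounds its size by the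
    peak. *)
Lemma gauss_lipschitz s t : `|gauss s - gauss t| <= gauss_peak * `|s - t|.
Proof.
have k0 := ltW gauss_peak_gt0.
wlog st : s t / t <= s.
  move=> H; have [/H//|/ltW/H] := leP t s.
  by rewrite distrC [`|t - s|]distrC.
have [||x _ ->] := @MVT_segment R gauss (fun x => - x * gauss x) t s st.
- by move=> x _; exact: is_derive_gauss.
- apply: derivable_within_continuous => x _.
  by have [] := is_derive_gauss x.
rewrite normrM ler_wpM2r// normrM normrN gaussE.
rewrite normrM (gtr0_norm gauss_peak_gt0) (gtr0_norm (expR_gt0 _)) mulrCA ler_piMr//.
rewrite expRN ler_pdivrMr ?expR_gt0// mul1r.
apply: le_trans (expR_ge1Dx _).
rewrite -(real_normK (num_real x)); have := sqr_ge0 (`|x| - 1); nra.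
Qed.

Lemma continuous_gauss : continuous gauss.
Proof. exact/continuous_normal_pdf/oner_neq0. Qed.

Lemma integrable_gauss (A : set R) : measurable A ->
  mu.-integrable A (EFin \o gauss).
Proof.
by move=> mA; apply: (integrableS measurableT) => //; exact: integrable_normal_pdf.
Qed.

Lemma is_derive_gauss_cdf (t : R) : is_derive t (1 : R) gauss_cdf (gauss t).
Proof.
have [||||dF F'] := @continuous_FTC1 R gauss -oo%O t (t + 1).
- by rewrite ltrDl.
- exact: integrable_gauss.
- by rewrite ltNyr.
- exact: continuous_gauss.
by rewrite derive1E in F'; exact: DeriveDef.
Qed.

Lemma gauss_cdf_MVT s t : s < t ->
  exists2 x, s < x < t & gauss_cdf t - gauss_cdf s = gauss x * (t - s).
Proof.
move=> st; have [||x] := @MVT R gauss_cdf gauss s t st.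
- by move=> x _; exact: is_derive_gauss_cdf.
- apply: derivable_within_continuous => x _.
  by have [] := is_derive_gauss_cdf x.
by rewrite in_itv; exists x.
Qed.

Lemma gauss_cdf_incr s t : s < t -> gauss_cdf s < gauss_cdf t.
Proof.
move=> st; have [x _ E] := gauss_cdf_MVT st.
by rewrite -subr_gt0 E mulr_gt0 ?gauss_gt0// subr_gt0.
Qed.

Let idTR : measurableTypeR R -> R := idfun.

#[local] HB.instance Definition _ :=
  @isMeasurableFun.Build _ _ _ _ idTR (@measurable_id _ _ setT).

(** Identifies [gauss_cdf] with the distribution function of the identity under the normal law, from
    which the limits at infinity are inherited. *)
Lemma gauss_cdfE x : gauss_cdf x = fine (cdf (idTR : {RV (normal_prob 0 1) >-> R}) x).
Proof. by rewrite /gauss_cdf /Rintegral /cdf /distribution /pushforward preimage_id. Qed.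

Lemma cvg_gauss_cdfy : gauss_cdf x @[x --> +oo] --> (1 : R).
Proof.
under eq_fun do rewrite gauss_cdfE.
exact/fine_cvg/cvg_cdfy1.
Qed.

Lemma cvg_gauss_cdfNy : gauss_cdf x @[x --> -oo] --> (0 : R).
Proof.
under eq_fun do rewrite gauss_cdfE.
exact/fine_cvg/cvg_cdfNy0.
Qed.

Lemma gauss_cdf_lt1 x : gauss_cdf x < 1.
Proof.
apply: (@lt_le_trans _ _ (gauss_cdf (x + 1))); first by rewrite gauss_cdf_incr// ltrDl.
by rewrite gauss_cdfE -lee_fin fineK ?fin_num_measure// cdf_le1.
Qed.

Lemma gauss_cdf_gt0 x : 0 < gauss_cdf x.
Proof.
apply: (@le_lt_trans _ _ (gauss_cdf (x - 1))).
  by rewrite gauss_cdfE fine_ge0.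
by rewrite gauss_cdf_incr// ltrBlDr ltrDl.
Qed.

Lemma gauss_cdf_surj p : 0 < p < 1 -> exists t, gauss_cdf t = p.
Proof.
move=> /andP[p0 p1].
have [b pb] : exists b, p < gauss_cdf b.
  have /cvgrPdist_lt/(_ (1 - p)) := cvg_gauss_cdfy; rewrite subr_gt0 => /(_ p1).
  move=> [b [_ /(_ (b + 1))]]; rewrite ltrDl => /(_ ltr01).
  by rewrite ger0_norm ?subr_ge0 ?ltW ?gauss_cdf_lt1// => H; exists (b + 1); lra.
have [a ap] : exists a, gauss_cdf a < p.
  have /cvgrPdist_lt/(_ p p0) := cvg_gauss_cdfNy.
  move=> [a [_ /(_ (a - 1))]]; rewrite ltrBlDr ltrDl => /(_ ltr01).
  by rewrite sub0r normrN gtr0_norm ?gauss_cdf_gt0//; exists (a - 1).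
have ab : a <= b.
  rewrite leNgt; apply/negP => /gauss_cdf_incr; lra.
have [||c _ <-] := @IVT R gauss_cdf a b p ab.
- apply: derivable_within_continuous => x _.
  by have [] := is_derive_gauss_cdf x.
- by rewrite ge_min le_max (ltW ap) (ltW pb) orbT.
by exists c.
Qed.

Lemma gauss_cdf_taylor s t :
  `|gauss_cdf t - gauss_cdf s - gauss s * (t - s)| <= gauss_peak * (t - s) ^+ 2.
Proof.
wlog: / exists x, `|x - s| <= `|t - s| /\ gauss_cdf t - gauss_cdf s = gauss x * (t - s).
  apply; have [st|ts|->] := ltgtP s t.
  - have [x /andP[sx xt] E] := gauss_cdf_MVT st; exists x; split => //.
    by rewrite !ger0_norm; lra.
  - have [x /andP[sx xt] E] := gauss_cdf_MVT ts; exists x; split => //.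
      by rewrite !ler0_norm; lra.
    by rewrite -opprB E; ring.
  - by exists t; split => //; rewrite !subrr mulr0.
move=> [x [xs ->]]; rewrite -mulrBl normrM -(real_normK (num_real (t - s))) expr2 mulrA.
rewrite ler_wpM2r// (le_trans (gauss_lipschitz _ _))// ler_wpM2l//.
exact/ltW/gauss_peak_gt0.
Qed.

(** Compares one term of an upper Riemann sum with the Gaussian mass of its cell. The excess is of
    second order in [d], so it still vanishes after summation over about 1/d cells. *)
Lemma gauss_cell a d t : 0 < d -> a <= t <= a + d ->
  d * gauss t <= gauss_cdf (a + d) - gauss_cdf a + gauss_peak * d ^+ 2.
Proof.
move=> d0 /andP[at_ td].
have [|x /andP[ax xd] ->] := @gauss_cdf_MVT a (a + d); first by rewrite ltrDl.
have : `|gauss t - gauss x| <= gauss_peak * d.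
  apply: le_trans (gauss_lipschitz _ _) _; rewrite ler_wpM2l//.
    exact/ltW/gauss_peak_gt0.
  by rewrite ler_norml; lra.
rewrite ler_norml => /andP[_ H].
rewrite [a + d]addrC addrK [gauss x * _]mulrC expr2 mulrA [gauss_peak * d * d]mulrC -mulrDr.
by rewrite ler_pM2l//; lra.
Qed.

End gaussian.

(** * The transport map *)

Section gauss_quantile.
Context {R : realType}.

(* Junk value [0] outside of ]0, 1[. *)
Definition gauss_quantile (p : R) : R := xget 0 [set t : R | gauss_cdf t = p].

Lemma gauss_quantileK p : 0 < p < 1 -> gauss_cdf (gauss_quantile p) = p.
Proof.
move=> /gauss_cdf_surj[t tp]; rewrite /gauss_quantile.
by case: xgetP => [_ -> //|/(_ t)].
Qed.

Lemma gauss_quantile_le p q : 0 < p -> q < 1 -> p <= q ->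
  gauss_quantile p <= gauss_quantile q.
Proof.
move=> p0 q1 pq; rewrite leNgt; apply/negP => /gauss_cdf_incr.
rewrite !gauss_quantileK; lra.
Qed.

(** A mean value statement free of any order on [s] and [t]; the bound on [x] keeps it where the
    density has a positive lower bound. *)
Lemma gauss_cdf_diff (s t : R) : exists2 x,
  `|x| <= Num.max `|s| `|t| & gauss_cdf t - gauss_cdf s = gauss x * (t - s).
Proof.
have [st|ts|->] := ltgtP s t.
- have [x /andP[sx xt] E] := gauss_cdf_MVT st; exists x => //.
  rewrite le_max; have [x0|x0] := leP 0 x; apply/orP.
    by right; rewrite !ger0_norm; lra.
  by left; rewrite !ler0_norm; lra.
- have [x /andP[sx xt] E] := gauss_cdf_MVT ts; exists x => //.
    rewrite le_max; have [x0|x0] := leP 0 x; apply/orP.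
      by left; rewrite !ger0_norm; lra.
    by right; rewrite !ler0_norm; lra.
  by rewrite -opprB E; ring.
- by exists t; rewrite ?le_max ?lexx// !subrr mulr0.
Qed.

Lemma gauss_ge_norm (s t : R) : `|s| <= `|t| -> gauss t <= gauss s.
Proof.
move=> st; rewrite !gaussE ler_pM2l ?gauss_peak_gt0// ler_expR lerN2.
rewrite ler_pM2r ?invr_gt0// -(real_normK (num_real s)) -(real_normK (num_real t)).
by rewrite ler_pXn2r// nnegrE.
Qed.

Lemma ln_gauss (t : R) : ln (gauss t) = ln (@gauss_peak R) - t ^+ 2 / 2.
Proof. by rewrite gaussE lnM ?posrE ?gauss_peak_gt0 ?expR_gt0// expRK. Qed.

Lemma gauss_eq_sqr (s t : R) : gauss s = gauss t -> s ^+ 2 = t ^+ 2.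
Proof. by move=> st; have := ln_gauss s; rewrite st ln_gauss; lra. Qed.

End gauss_quantile.

Section transport.
Context {R : realType} {n N : nat}.
Variables (c : 'I_N -> R) (u : 'I_N -> 'cV[R]_n) (a : 'I_N -> R).
Hypotheses (c0 : forall i, 0 <= c i) (u1 : forall i, dotv (u i) (u i) = 1).
Hypothesis (cu1 : frame_mx c u (fun=> 1) = 1%:M).
Local Notation k := (@gauss_peak R).

Definition slab_pos i (y : 'cV[R]_n) : R := dotv (u i) y - a i.

(** For [r > 0] the quantiles stay bounded on this set; [r = 0] gives the intersection of slabs
    itself. *)
Definition slab_body (r : R) : set 'cV[R]_n :=
  [set y | forall i, r <= slab_pos i y <= 1 - r].

Definition slab_gauss i y : R := gauss_quantile (slab_pos i y).

Definition transport y : 'cV[R]_n := \sum_i (c i * slab_gauss i y) *: u i.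

(** The derivative of [transport], since T'(p) = 1 / gauss(T p). *)
Definition transport_diff y : 'M[R]_n :=
  frame_mx c u (fun i => (gauss (slab_gauss i y))^-1).

Variable r : R.
Hypothesis r0 : 0 < r.

Let M := Num.max `|gauss_quantile r| `|gauss_quantile (1 - r)|.

Lemma slab_gaussK i y : slab_body r y -> gauss_cdf (slab_gauss i y) = slab_pos i y.
Proof.
move=> /(_ i)/andP[ry yr]; rewrite gauss_quantileK//.
by rewrite (lt_le_trans r0 ry) (le_lt_trans yr)// ltrBlDr ltrDl.
Qed.

Lemma slab_gauss_bound i y : slab_body r y -> `|slab_gauss i y| <= M.
Proof.
move=> /(_ i)/andP[ry yr].
have h1 : gauss_quantile r <= slab_gauss i y.
  by apply: gauss_quantile_le => //; rewrite (le_lt_trans yr)// ltrBlDr ltrDl.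
have h2 : slab_gauss i y <= gauss_quantile (1 - r).
  by apply: gauss_quantile_le => //; [exact: lt_le_trans ry|rewrite ltrBlDr ltrDl].
have [x0|x0] := leP 0 (slab_gauss i y); rewrite le_max; apply/orP.
  by right; rewrite !ger0_norm; lra.
by left; rewrite !ler0_norm; lra.
Qed.

Let gmin : R := gauss M.

Lemma gmin_gt0 : 0 < gmin. Proof. exact: gauss_gt0. Qed.

Lemma gmin_le (t : R) : `|t| <= M -> gmin <= gauss t.
Proof.
by move=> tM; apply: gauss_ge_norm; rewrite (le_trans tM)// ler_norm.
Qed.

Section two_points.
Variables x y : 'cV[R]_n.
Hypotheses (xr : slab_body r x) (yr : slab_body r y).
Let dp i := dotv (u i) (y - x).
Let dt i := slab_gauss i y - slab_gauss i x.

Let dpE i : exists2 g, gmin <= g <= k & dp i = g * dt i.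
Proof.
have [xi xiM E] := gauss_cdf_diff (slab_gauss i x) (slab_gauss i y).
exists (gauss xi).
  rewrite gauss_le_peak andbT gmin_le// (le_trans xiM)//.
  by rewrite ge_max !slab_gauss_bound.
by rewrite -E !slab_gaussK// /dp dotvBr /slab_pos; lra.
Qed.

Let transportB : transport y - transport x = \sum_i (c i * dt i) *: u i.
Proof.
rewrite /transport -sumrB; apply: eq_bigr => i _.
by rewrite -scalerBl -mulrBr.
Qed.

(** The slope of [gauss_cdf] is at most [k], so Parseval gives |w|^2 <= k <v, w> for w = y - x and v
    the difference of the images; expanding |k v - w|^2 >= 0 concludes. This bounds the size of the
    preimage of a grid cell. *)
Lemma transport_expansive :
  dotv (y - x) (y - x) <= k ^+ 2 * dotv (transport y - transport x) (transport y - transport x).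
Proof.
have k0 := @gauss_peak_gt0 R.
have H : dotv (y - x) (y - x) <= k * dotv (transport y - transport x) (y - x).
  rewrite -(frame_parseval cu1) transportB dotv_suml mulr_sumr.
  apply: ler_sum => i _; rewrite dotvZl -/(dp i).
  have [g /andP[gg gk] ->] := dpE i.
  have g0 := lt_le_trans gmin_gt0 gg.
  rewrite -!mulrA [leRHS]mulrCA ler_wpM2l//.
  have : 0 <= g * dt i ^+ 2 * (k - g) by rewrite mulr_ge0 ?subr_ge0// mulr_ge0 ?sqr_ge0// ltW.
  by nra.
move: (y - x) (transport y - transport x) H => w v H.
have := dotv_ge0 (k *: v - w).
rewrite dotvBl !dotvBr !dotvZl !dotvZr (dotvC w v) mulrA -expr2.
by lra.
Qed.

(** In each direction the linearization of T has error at most (k / g) dt^2, where g >= gmin and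
    dt^2 <= dp^2 / gmin^2: this is the origin of k / gmin^3. Parseval then sums the
    [c i * dp i ^+ 2]. *)
Lemma transport_taylor j :
  `|(transport_diff x *m (y - x) - (transport y - transport x)) j ord0| <=
  k / gmin ^+ 3 * dotv (y - x) (y - x).
Proof.
have g0 := gmin_gt0.
rewrite /transport_diff frame_mx_mul transportB -sumrB summxE.
apply: le_trans (ler_norm_sum _ _ _) _.
rewrite -(frame_parseval cu1) mulr_sumr; apply: ler_sum => i _.
rewrite -scalerBl mxE -/(dp i) -mulrA -mulrBr normrM normrM (ger0_norm (c0 i)).
rewrite [leRHS]mulrCA -mulrA ler_wpM2l//.
have uj : `|u i j ord0| <= 1.
  by rewrite -ler_sqr ?nnegrE// expr1n real_normK ?num_real// -(u1 i) sqr_coord_le_dotv.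
apply: (@le_trans _ _ `|(gauss (slab_gauss i x))^-1 * dp i - dt i|).
  by rewrite ler_piMr.
set g := gauss _; have gg : gmin <= g by rewrite gmin_le// slab_gauss_bound.
have gp : 0 < g := lt_le_trans g0 gg.
have -> : g^-1 * dp i - dt i = g^-1 * (dp i - g * dt i).
  by rewrite mulrBr mulKf// gt_eqF.
have T := gauss_cdf_taylor (slab_gauss i x) (slab_gauss i y).
rewrite !slab_gaussK// -/g -/(dt i) in T.
have Ep : slab_pos i y - slab_pos i x = dp i by rewrite /slab_pos /dp dotvBr; lra.
rewrite Ep in T.
rewrite normrM gtr0_norm ?invr_gt0//.
have dt2 : dt i ^+ 2 <= dp i ^+ 2 / gmin ^+ 2.
  rewrite ler_pdivlMr ?exprn_gt0// -exprMn.
  have [h /andP[gh _] ->] := dpE i.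
  rewrite -[leLHS](real_normK (num_real _)) -[leRHS](real_normK (num_real _)).
  rewrite ler_sqr ?nnegrE// !normrM [leLHS]mulrC ler_wpM2r// !gtr0_norm//.
  exact: lt_le_trans g0 gh.
apply: (@le_trans _ _ (gmin^-1 * (k * (dp i ^+ 2 / gmin ^+ 2)))).
  apply: ler_pM => //; first by rewrite invr_ge0 ltW.
    by rewrite lef_pV2.
  apply: le_trans T _; rewrite ler_wpM2l//; exact/ltW/gauss_peak_gt0.
rewrite le_eqVlt; apply/orP; left; apply/eqP.
by rewrite -/(dp i) expr2; field; rewrite gt_eqF.
Qed.

End two_points.

Lemma dotv_le_coord (v : 'cV[R]_n) d : (forall j, `|v j ord0| <= d) ->
  dotv v v <= n%:R * d ^+ 2.
Proof.
move=> vd; rewrite dotvE.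
apply: (@le_trans _ _ (\sum_(i < n) d ^+ 2)).
  apply: ler_sum => i _; rewrite -expr2 -[leLHS](real_normK (num_real _)).
  by rewrite ler_sqr ?nnegrE// (le_trans _ (vd i)).
by rewrite sumr_const card_ord mulr_natl.
Qed.

(** Two points with images in a common cell of side [d] satisfy |y - x|^2 <= k^2 n d^2, so the
    linearization error there is at most [C * d ^+ 2]. *)
Let C : R := k / gmin ^+ 3 * (k ^+ 2 * n%:R).

Let C_ge0 : 0 <= C.
Proof.
have k0 := ltW (@gauss_peak_gt0 R).
rewrite mulr_ge0 ?divr_ge0 ?exprn_ge0 ?mulr_ge0 ?ler0n ?exprn_ge0//.
exact/ltW/gmin_gt0.
Qed.

Lemma transport_diff_det_gt0 x : 0 < \det (transport_diff x).
Proof. by apply: frame_det_gt0 => // i; rewrite invr_gt0 gauss_gt0. Qed.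

(** [P] is the preimage, under the linearization at [x], of the cell enlarged by [C * d ^+ 2] on
    every side; being an affine preimage of a cube, it has a known volume. *)
Lemma transport_cell x z d : slab_body r x -> 0 < d -> cube z d (transport x) ->
  exists P, [/\ meas P,
    forall y, slab_body r y -> cube z d (transport y) -> P y &
    volume P = ((d + 2 * C * d ^+ 2) ^+ n / \det (transport_diff x))%:E].
Proof.
move=> xr d0 xz; pose S := transport_diff x; have S0 := transport_diff_det_gt0 x.
have uS : S \in unitmx by rewrite unitmxE unitfE gt_eqF.
pose e := C * d ^+ 2; have e0 : 0 <= e by rewrite mulr_ge0// sqr_ge0.
pose b := transport x - S *m x.
exists [set y | cube (z - const_mx e) (d + 2 * C * d ^+ 2) (S *m y + b)]; split.
- exact: (meas_affine _ _ (meas_cube _ _)).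
- move=> y yr yz j.
  have yxd : dotv (transport y - transport x) (transport y - transport x) <= n%:R * d ^+ 2.
    apply: dotv_le_coord => i; have := xz i; have := yz i; rewrite !mxE ler_norml.
    by move=> /andP[? ?] /andP[? ?]; apply/andP; split; lra.
  have yx : dotv (y - x) (y - x) <= k ^+ 2 * n%:R * d ^+ 2.
    apply: le_trans (transport_expansive xr yr) _.
    by rewrite -mulrA ler_wpM2l// exprn_ge0// ltW// gauss_peak_gt0.
  have T := transport_taylor xr yr j.
  have {}T : `|(S *m (y - x) - (transport y - transport x)) j ord0| <= e.
    apply: le_trans T _; rewrite /e /C -[leRHS]mulrA ler_wpM2l//.
    by rewrite divr_ge0 ?exprn_ge0 ?ltW ?gauss_peak_gt0 ?gmin_gt0.
  have E : S *m y + b = (S *m (y - x) - (transport y - transport x)) + transport y.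
    by rewrite /b mulmxBr opprB !addrA subrK addrAC.
  rewrite E; move: T (yz j); rewrite ler_norml => /andP[].
  move: (S *m (y - x) - (transport y - transport x)) => v.
  rewrite !mxE.
  rewrite -mulrA -/e => ? ? /andP[? ?]; apply/andP; split; lra.
rewrite volume_affine//; last exact: meas_cube.
rewrite volume_cube; last by rewrite addr_ge0 ?(ltW d0)// -mulrA mulr_ge0.
by rewrite -EFinM gtr0_norm// mulrC.
Qed.

(** In logarithms: as the [c i] add up to n, the weighted sum of the ln gauss(T_i) is n ln k - (1/2)
    sum c_i T_i^2, and [frame_norm_le] replaces the last sum by |Theta|^2. *)
Lemma transport_inv_det_le x th : 0 < th ->
  ln th + \sum_i c i * ln (gauss (slab_gauss i x))^-1 <= ln (\det (transport_diff x)) ->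
  (\det (transport_diff x))^-1 <= \prod_j gauss (transport x j ord0) * th^-1.
Proof.
move=> th0; have S0 := transport_diff_det_gt0 x.
have P0 : 0 < \prod_j gauss (transport x j ord0).
  by apply: prodr_gt0 => j _; exact: gauss_gt0.
move=> H; rewrite -ler_ln ?posrE ?mulr_gt0 ?invr_gt0//.
rewrite lnM ?posrE ?invr_gt0// !lnV ?posrE// ln_prod => [|j]; last exact: gauss_gt0.
under eq_bigr do rewrite ln_gauss.
rewrite sumrB sumr_const card_ord -mulr_suml.
under eq_bigr do rewrite expr2.
rewrite -dotvE.
have := frame_norm_le cu1 (fun i => slab_gauss i x) c0; rewrite -/(transport x).
move: H; under eq_bigr do rewrite lnV ?posrE ?gauss_gt0// ln_gauss mulrN mulrBr mulrA.
rewrite sumrN sumrB -!mulr_suml (frame_trace cu1 u1) mulr_natl.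
by lra.
Qed.

Lemma meas_slab_body : meas (slab_body r).
Proof.
pose U : 'M[R]_(N, n) := \matrix_(i, j) u i j ord0.
rewrite (_ : slab_body r =
    [set y | cube (const_mx r) (1 - 2 * r) (U *m y + (- \col_i a i))]).
  exact: (meas_affine _ _ (meas_cube _ _)).
have E y i : (U *m y + (- \col_i a i)) i ord0 = slab_pos i y.
  rewrite /slab_pos dotvE !mxE; congr (_ - _); apply: eq_bigr => j _.
  by rewrite mxE.
by apply/seteqP; split => y H i; have := H i; rewrite E mxE => /andP[? ?];
  apply/andP; split; lra.
Qed.

Lemma transport_bound y j : slab_body r y -> `|transport y j ord0| <= n%:R * M.
Proof.
move=> yr; rewrite /transport summxE -(frame_trace cu1 u1) mulr_suml.
apply: le_trans (ler_norm_sum _ _ _) _; apply: ler_sum => i _.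
rewrite mxE !normrM (ger0_norm (c0 i)) -mulrA ler_wpM2l//.
rewrite -[leRHS]mulr1 ler_pM//; first exact: slab_gauss_bound.
by rewrite -ler_sqr ?nnegrE// expr1n real_normK ?num_real// -(u1 i) sqr_coord_le_dotv.
Qed.

(* The factor [th] gained by the determinant on [B] makes the bound strict in the
   equality case; it is irrelevant for [B = set0], [th = 1]. *)
Section grid.
Variables (B : set 'cV[R]_n) (th : R).
Hypotheses (th1 : 1 <= th) (mB : meas B) (Br : B `<=` slab_body r).
Hypothesis thB : forall y, B y ->
  ln th + \sum_i c i * ln (gauss (slab_gauss i y))^-1 <= ln (\det (transport_diff y)).

Variable d : R.
Hypotheses (d0 : 0 < d) (d1 : d < 1).

(** [m] cells on each side of the origin reach beyond [n%:R * M], which bounds the coordinates of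
    [transport]. *)
Let m : nat := (Num.truncn (n%:R * M / d)).+1.
Let corner (f : {ffun 'I_n -> 'I_(m + m)}) : 'cV[R]_n := \col_j (((f j)%:R - m%:R) * d).
(** Mass of the i-th interval plus the error of [gauss_cell]; the 2m errors add up to 2 m k d^2,
    which is of order [d]. *)
Let h (i : 'I_(m + m)) : R :=
  gauss_cdf ((i%:R - m%:R) * d + d) - gauss_cdf ((i%:R - m%:R) * d) + k * d ^+ 2.
Let hits (X : set 'cV[R]_n) f := `[< exists2 y, X y & cube (corner f) d (transport y) >].

Let M_ge0 : 0 <= n%:R * M.
Proof. by rewrite mulr_ge0// le_max normr_ge0. Qed.

Let m_bound : n%:R * M < m%:R * d <= n%:R * M + 1.
Proof.
have q0 : 0 <= n%:R * M / d by rewrite divr_ge0// ltW.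
have /andP[ml mu] := truncn_itv q0.
rewrite -ltr_pdivrMr// mu/= /m -natr1 mulrDl mul1r lerD ?(ltW d1)//.
by rewrite -ler_pdivlMr.
Qed.

Let h_ge (i : 'I_(m + m)) t : (i%:R - m%:R) * d <= t <= (i%:R - m%:R) * d + d ->
  d * gauss t <= h i.
Proof. exact: gauss_cell. Qed.

Let h_ge0 i : 0 <= h i.
Proof.
apply: (@le_trans _ _ (d * gauss ((i%:R - m%:R) * d))).
  by rewrite mulr_ge0// ltW// gauss_gt0.
by apply: h_ge; rewrite lexx lerDl ltW.
Qed.

Let sum_h : \sum_i h i <= 1 + 2 * k * (n%:R * M + 1) * d.
Proof.
rewrite /h big_split /=.
pose F (i : nat) := gauss_cdf ((i%:R - m%:R) * d).
have -> : \sum_(i < m + m) (gauss_cdf ((i%:R - m%:R) * d + d) -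
    gauss_cdf ((i%:R - m%:R) * d)) = F (m + m)%N - F 0%N.
  transitivity (\sum_(0 <= i < m + m) (F i.+1 - F i)); last exact: telescope_sumr.
  rewrite big_mkord; apply: eq_bigr => i _.
  by rewrite /F -natr1; congr (gauss_cdf _ - _); ring.
rewrite sumr_const card_ord -[_ *+ _]mulr_natl natrD.
have F1 : F (m + m)%N < 1 := gauss_cdf_lt1 _.
have F0 : 0 < F 0%N := gauss_cdf_gt0 _.
have /andP[_ mM] := m_bound.
have k0 := @gauss_peak_gt0 R.
have H : 0 <= k * d * (n%:R * M + 1 - m%:R * d).
  by rewrite mulr_ge0 ?subr_ge0// mulr_ge0// ltW.
move: (F _) (F _) F1 F0 => F1 F0 ? ?.
move: (m%:R) (n%:R * M) H => m' M' H; nra.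
Qed.

Let grid_cover y : slab_body r y -> exists f, cube (corner f) d (transport y).
Proof.
move=> yr; have /andP[mM _] := m_bound.
pose q j := (transport y j ord0 + m%:R * d) / d.
have yb j := transport_bound j yr.
have q0 j : 0 <= q j.
  by have := yb j; rewrite ler_norml => /andP[? _]; rewrite divr_ge0 ?(ltW d0)//; lra.
have qm j : (Num.truncn (q j) < m + m)%N.
  have /andP[tq _] := truncn_itv (q0 j).
  rewrite -(ltr_nat R) (le_lt_trans tq)// /q ltr_pdivrMr// natrD mulrDl ltrD2r.
  by have := yb j; rewrite ler_norml => /andP[_ ?]; lra.
exists [ffun j => Ordinal (qm j)] => j; rewrite mxE ffunE /=.
have /andP[tq qt] := truncn_itv (q0 j).
move: (Num.truncn (q j)) tq qt => t; rewrite /q ler_pdivlMr// ltr_pdivrMr// -natr1.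
move: (t%:R : R) (transport y j ord0) (m%:R : R) => t' x m1.
by move=> ? ?; apply/andP; split; nra.
Qed.

Let E : R := (1 + 2 * C * d) ^+ n.

Let E_ge0 : 0 <= E.
Proof. by rewrite exprn_ge0// addr_ge0// mulr_ge0 ?(ltW d0)// mulr_ge0. Qed.

Let H (f : {ffun 'I_n -> 'I_(m + m)}) : R := \prod_j h (f j).

Let H_ge0 f : 0 <= H f. Proof. exact: prodr_ge0. Qed.

Let cell_volume x f t : slab_body r x -> cube (corner f) d (transport x) -> 0 < t ->
  ln t + \sum_i c i * ln (gauss (slab_gauss i x))^-1 <= ln (\det (transport_diff x)) ->
  (d + 2 * C * d ^+ 2) ^+ n / \det (transport_diff x) <= E * H f * t^-1.
Proof.
move=> xr xf t0 xt.
have -> : (d + 2 * C * d ^+ 2) ^+ n = E * d ^+ n.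
  by rewrite -exprMn; congr (_ ^+ _); ring.
rewrite -!mulrA ler_wpM2l//.
apply: le_trans (ler_wpM2l (exprn_ge0 _ (ltW d0)) (transport_inv_det_le t0 xt)) _.
rewrite mulrA ler_wpM2r ?invr_ge0 ?(ltW t0)//.
have -> : d ^+ n = \prod_(j < n) d by rewrite prodr_const card_ord.
rewrite -big_split /=; apply: ler_prod => j _.
rewrite mulr_ge0 ?(ltW d0) ?(ltW (gauss_gt0 _))//=.
by apply: h_ge; have := xf j; rewrite mxE.
Qed.

(** A cell hit by the image of [B] is linearized at a point of [B], so the whole cell benefits from
    the factor [th]. A cell missed by the image of the body gets the empty set. *)
Let cells : exists P : {ffun 'I_n -> 'I_(m + m)} -> set 'cV[R]_n, forall f,
  [/\ meas (P f),
      forall y, slab_body r y -> cube (corner f) d (transport y) -> P f y &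
      (volume (P f) <= (E * H f * (if hits B f then th^-1 else 1))%:E)%E].
Proof.
suff /choice[P HP] : forall f, exists Pf, [/\ meas Pf,
      forall y, slab_body r y -> cube (corner f) d (transport y) -> Pf y &
      (volume Pf <= (E * H f * (if hits B f then th^-1 else 1))%:E)%E].
  by exists P.
move=> f; case: ifPn => [/asboolP[x Bx xf]|_].
  have xr := Br Bx.
  have [P [mP Pf vP]] := transport_cell xr d0 xf; exists P; split => //.
  rewrite vP lee_fin; apply: cell_volume => //; last exact: thB.
  exact: lt_le_trans th1.
have [[x xr xf]|nohit] := pselect (exists2 y, slab_body r y & cube (corner f) d (transport y)).
  have [P [mP Pf vP]] := transport_cell xr d0 xf; exists P; split => //.
  rewrite vP lee_fin; have := cell_volume xr xf ltr01; rewrite invr1; apply.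
  rewrite ln1 add0r.
  by apply: ln_frame_det => // i; rewrite invr_gt0 gauss_gt0.
exists set0; split.
- by rewrite /meas preimage_set0.
- by move=> y yr yf; case: nohit; exists y.
- by rewrite volumeE preimage_set0 measure0 lee_fin mulr1 mulr_ge0.
Qed.

(** Hit cells contribute at most E H / th each, and the volume of [B] is at most the sum of E H over
    them. Adding (1 - 1/th) times that volume thus gives back at most the full sum of E H, which
    factors into one-dimensional sums. *)
Lemma slab_volume_grid :
  (volume (slab_body r) + (1 - th^-1)%:E * volume B <=
   ((1 + 2 * C * d) ^+ n * (1 + 2 * k * (n%:R * M + 1) * d) ^+ n)%:E)%E.
Proof.
have th0 : 0 < th by exact: lt_le_trans th1.
have thV : th^-1 <= 1 by rewrite invf_le1.
have [P HP] := cells.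
have vL : (volume (slab_body r) <=
    (\sum_f E * H f * (if hits B f then th^-1 else 1))%:E)%E.
  apply: (@le_trans _ _ (\sum_f volume (P f))%E).
    apply: volume_sub_sum => [|f _|y yr]; first exact: meas_slab_body.
      by have [] := HP f.
    by have [f yf] := grid_cover yr; exists f => //; have [_ + _] := HP f; exact.
  by rewrite -sumEFin; apply: lee_sum => f _; have [] := HP f.
have vB : (volume B <= (\sum_(f | hits B f) E * H f)%:E)%E.
  apply: (@le_trans _ _ (\sum_(f | hits B f) volume (P f))%E).
    apply: volume_sub_sum => // [f _|y By]; first by have [] := HP f.
    have [f yf] := grid_cover (Br By); exists f; first by apply/asboolP; exists y.
    by have [_ + _] := HP f; apply => //; exact: Br.
  rewrite -sumEFin; apply: lee_sum => f hf; have [_ _] := HP f; rewrite hf.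
  move=> /le_trans; apply; rewrite lee_fin ler_piMr// mulr_ge0//.
have tV0 : 0 <= 1 - th^-1 by rewrite subr_ge0.
apply: le_trans (leeD vL (lee_wpmul2l _ vB)) _; first by rewrite lee_fin.
rewrite -EFinM -EFinD lee_fin.
apply: (@le_trans _ _ (E * (\sum_i h i) ^+ n)); last first.
  rewrite /E ler_wpM2l// lerXn2r ?nnegrE//; first exact: sumr_ge0.
  by rewrite (le_trans _ sum_h)// sumr_ge0.
have -> : (\sum_i h i) ^+ n = \sum_f H f.
  transitivity (\prod_(j < n) \sum_i h i); last by rewrite bigA_distr_bigA.
  by rewrite prodr_const card_ord.
rewrite [leRHS]mulr_sumr (bigID (hits B)) [leRHS](bigID (hits B)) /=.
rewrite -addrA [X in _ + X <= _]addrC addrA mulr_sumr -big_split /=.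
rewrite lerD//; apply: ler_sum => f hf; last by rewrite (negPf hf) mulr1.
by rewrite hf [(1 - _) * _]mulrC -mulrDr subrKC mulr1.
Qed.

End grid.

End transport.

(** * The volume of an intersection of slabs *)

Section limits.
Context {R : realType}.

(** Since (1 + y)^n <= exp(n y), the right side is at most exp(K d); if ln x > 0, the [d] chosen
    below lies in ]0, 1[ and makes K d smaller than ln x. *)
Lemma le1_of_small_powers (x A B : R) n : 0 <= A -> 0 <= B ->
  (forall d, 0 < d -> d < 1 -> x <= (1 + A * d) ^+ n * (1 + B * d) ^+ n) -> x <= 1.
Proof.
move=> A0 B0 H; rewrite leNgt; apply/negP => x1.
have l0 := ln_gt0 x1; set l := ln x in l0.
pose K : R := n%:R * (A + B); have K0 : 0 <= K by rewrite mulr_ge0// addr_ge0.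
pose d := l / (l + 1 + K).
have D0 : 0 < l + 1 + K by rewrite ltr_pwDl// addr_gt0.
have d0 : 0 < d by rewrite divr_gt0.
have d1 : d < 1 by rewrite ltr_pdivrMr// mul1r -addrA ltrDl ltr_pwDl.
have : x <= expR (K * d).
  apply: le_trans (H d d0 d1) _.
  have P y : 0 <= y -> (1 + y) ^+ n <= expR (n%:R * y).
    by move=> y0; rewrite mulrC expRM_natr lerXn2r ?nnegrE ?expR_ge0 ?addr_ge0// expR_ge1Dx.
  have Ad : 0 <= A * d by rewrite mulr_ge0// ltW.
  have Bd : 0 <= B * d by rewrite mulr_ge0// ltW.
  rewrite /K mulrDr mulrDl expRD -!mulrA; apply: ler_pM; try exact: P.
    by rewrite exprn_ge0// addr_ge0.
  by rewrite exprn_ge0// addr_ge0.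
rewrite -ler_ln ?posrE ?expR_gt0 ?(lt_trans ltr01 x1)// expRK -/l.
rewrite /d mulrA ler_pdivlMr//; nra.
Qed.

Section cvg_bigop.
Context (T : Type) (F : set_system T) (FF : Filter F).

Lemma cvg_sumr (I : Type) (r : seq I) (f : I -> T -> R) (l : I -> R) :
  (forall i, f i x @[x --> F] --> l i) ->
  \sum_(i <- r) f i x @[x --> F] --> \sum_(i <- r) l i.
Proof.
move=> fl; elim: r => [|i r IH].
  by rewrite big_nil; under eq_fun do rewrite big_nil; exact: cvg_cst.
by rewrite big_cons; under eq_fun do rewrite big_cons; exact: cvgD.
Qed.

Lemma cvg_prodr (I : Type) (r : seq I) (f : I -> T -> R) (l : I -> R) :
  (forall i, f i x @[x --> F] --> l i) ->
  \prod_(i <- r) f i x @[x --> F] --> \prod_(i <- r) l i.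
Proof.
move=> fl; elim: r => [|i r IH].
  by rewrite big_nil; under eq_fun do rewrite big_nil; exact: cvg_cst.
by rewrite big_cons; under eq_fun do rewrite big_cons; exact: cvgM.
Qed.

Lemma cvg_det n (f : T -> 'M[R]_n) (A : 'M[R]_n) :
  (forall i j, f x i j @[x --> F] --> A i j) -> \det (f x) @[x --> F] --> \det A.
Proof.
move=> fA; apply: cvg_sumr => s; apply: cvgM; first exact: cvg_cst.
by apply: cvg_prodr => i; exact: fA.
Qed.

End cvg_bigop.

End limits.

Section slab.
Context {R : realType} {n N : nat}.
Variables (c : 'I_N -> R) (u : 'I_N -> 'cV[R]_n) (a : 'I_N -> R).
Hypotheses (c0 : forall i, 0 <= c i) (u1 : forall i, dotv (u i) (u i) = 1).
Hypothesis (cu1 : frame_mx c u (fun=> 1) = 1%:M).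

Lemma slab_volume r B th : 0 < r -> 1 <= th -> meas B -> B `<=` slab_body u a r ->
  (forall y, B y -> ln th + \sum_i c i * ln (gauss (slab_gauss u a i y))^-1
     <= ln (\det (transport_diff c u a y))) ->
  (volume (slab_body u a r) + (1 - th^-1)%:E * volume B <= 1)%E.
Proof.
move=> r0 th1 mB Br thB.
have /= H d d0 d1 := slab_volume_grid c0 u1 cu1 r0 th1 mB Br thB (d := d) d0 d1.
have thV : 0 <= 1 - th^-1 by rewrite subr_ge0 invf_le1// (lt_le_trans _ th1).
move: H; set X := (_ + _)%E; set A := 2 * _; set M := n%:R * _ + 1 => H.
have X0 : (0 <= X)%E by rewrite adde_ge0// ?mule_ge0// ?lee_fin// volume_ge0.
have half1 : (2^-1 : R) < 1 by rewrite invf_lt1// ltr1n.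
have Xfin : X \is a fin_num.
  by rewrite ge0_fin_numE// (le_lt_trans (H 2^-1 _ half1))// ?ltry// invr_gt0.
rewrite -(fineK Xfin) lee_fin.
have k0 := ltW (@gauss_peak_gt0 R).
apply: (@le1_of_small_powers _ _ A (2 * gauss_peak * M) n).
- rewrite /A mulr_ge0// mulr_ge0//.
    by rewrite divr_ge0// exprn_ge0// ltW// gauss_gt0.
  by rewrite mulr_ge0// exprn_ge0.
- by rewrite /M !mulr_ge0// addr_ge0// mulr_ge0// le_max normr_ge0.
- by move=> d d0 d1; rewrite -lee_fin fineK// H.
Qed.

(** The homothety of ratio [s] about [y0] sends [slab_body u a 0] into
    [slab_body u a ((1 - s) * rho)] and costs a factor [s ^+ n], while [B] stays fixed and inside
    once (1 - s) rho <= r. Then [s] tends to 1. *)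
Lemma slab_volume0 y0 rho r B th : 0 < rho -> slab_body u a rho y0 ->
  0 < r -> 1 <= th -> meas B -> B `<=` slab_body u a r ->
  (forall y, B y -> ln th + \sum_i c i * ln (gauss (slab_gauss u a i y))^-1
     <= ln (\det (transport_diff c u a y))) ->
  (volume (slab_body u a 0) + (1 - th^-1)%:E * volume B <= 1)%E.
Proof.
move=> rho0 y0rho r0 th1 mB Br thB.
have thV : 0 <= 1 - th^-1 by rewrite subr_ge0 invf_le1// (lt_le_trans _ th1).
set b := (_ * volume B)%E; have b0 : (0 <= b)%E by rewrite mule_ge0// volume_ge0.
set v := volume _; have v0 : (0 <= v)%E := volume_ge0 _.
have H s : 0 < s -> s < 1 -> (1 - s) * rho <= r -> ((s ^+ n)%:E * v + b <= 1)%E.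
  move=> s0 s1 sr; have s'0 : 0 < (1 - s) * rho by rewrite mulr_gt0// subr_gt0.
  have Br' : B `<=` slab_body u a ((1 - s) * rho).
    move=> y /Br yr i; have /andP[? ?] := yr i.
    by rewrite (le_trans sr)//= (@le_trans _ _ (1 - r))// lerD2l lerN2.
  apply: le_trans (slab_volume s'0 th1 mB Br' thB).
  rewrite leeD2r//.
  have sN : s \is a GRing.unit by rewrite unitfE gt_eqF.
  have := @volume_affine R n (s^-1)%:M ((1 - s^-1) *: y0) (slab_body u a 0).
  rewrite unitmxE det_scalar unitrX ?unitrV// => /(_ isT (meas_slab_body _ _ _)).
  rewrite normrX normfV exprVn invrK gtr0_norm// => <-.
  apply: le_volume.
  - exact: (meas_affine _ _ (meas_slab_body _ _ _)).
  - exact: meas_slab_body.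
  move=> y /= yr i; have := yr i; have := y0rho i; rewrite /slab_pos.
  rewrite mul_scalar_mx dotvDr !dotvZr.
  set q := dotv (u i) y0; set p := s^-1 * dotv (u i) y + (1 - s^-1) * q.
  have -> : dotv (u i) y = s * p + (1 - s) * q.
    by rewrite /p; field; rewrite gt_eqF.
  by clearbody p q => /andP[? ?] /andP[? ?]; apply/andP; split; nra.
have [s1 [s10 s11 s1r]] : exists s, [/\ 0 < s, s < 1 & (1 - s) * rho <= r].
  exists (1 - Num.min 2^-1 (r / rho)); split.
  - rewrite subr_gt0; apply: (@le_lt_trans _ _ 2^-1); first by rewrite ge_min lexx.
    by rewrite invf_lt1// ltr1n.
  - by rewrite ltrBlDr ltrDl lt_min invr_gt0 ltr0n divr_gt0.
  - by rewrite opprB addrC subrK -ler_pdivlMr// ge_min lexx orbT.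
have bfin : b \is a fin_num.
  rewrite ge0_fin_numE//; apply: le_lt_trans (ltry 1).
  by apply: le_trans (H s1 s10 s11 s1r); rewrite leeDr// mule_ge0// lee_fin exprn_ge0// ltW.
have vfin : v \is a fin_num.
  rewrite ge0_fin_numE//; have : ((s1 ^+ n)%:E * v < +oo)%E.
    apply: le_lt_trans (ltry 1).
    by apply: le_trans (H s1 s10 s11 s1r); rewrite leeDl.
  move: v0; case: (v) => [x|_|//]; first by move=> *; rewrite ltry.
  by rewrite mulry gtr0_sg ?mul1e// exprn_gt0.
move: H; rewrite -(fineK vfin) -(fineK bfin) => H.
rewrite -EFinD lee_fin.
have x0 := fine_ge0 v0; set x := fine v in x0 H *; set z := fine b in H *.
apply/ler_addgt0Pr => e e0.
pose t := Num.min (1 - s1) (e / (n%:R * x + 1)).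
have nx0 : 0 < n%:R * x + 1 by rewrite ltr_wpDl// mulr_ge0.
have t0 : 0 < t by rewrite lt_min subr_gt0 s11 divr_gt0.
have ts : t <= 1 - s1 by rewrite ge_min lexx.
have te : t * (n%:R * x + 1) <= e by rewrite -ler_pdivlMr// ge_min lexx orbT.
have H' : (1 - t) ^+ n * x + z <= 1.
  have := H (1 - t); rewrite -EFinM -EFinD lee_fin; apply; [lra|lra|].
  by rewrite opprB addrC subrK (le_trans _ s1r)// ler_wpM2r// ltW.
have bern : 1 - n%:R * t <= (1 - t) ^+ n.
  have t1 : t <= 1 by lra.
  elim: (n) => [|p IH]; first by rewrite mul0r subr0 expr0.
  rewrite exprS -natr1; have p0 : 0 <= p%:R :> R by [].
  by move: (p%:R) p0 ((1 - t) ^+ p) IH => m m0 w; nra.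
have : (1 - n%:R * t) * x <= (1 - t) ^+ n * x by rewrite ler_wpM2r.
by move: ((1 - t) ^+ n) (n%:R) H' te => w m; nra.
Qed.

Lemma cvg_gauss_quantile (p : R) : 0 < p -> p < 1 ->
  gauss_quantile q @[q --> p] --> gauss_quantile p.
Proof.
move=> p0 p1; apply/cvgrPdist_lt => e e0.
set t := gauss_quantile p.
have tp : gauss_cdf t = p by rewrite gauss_quantileK// p0 p1.
have lp : gauss_cdf (t - e) < p by rewrite -tp gauss_cdf_incr// ltrBlDr ltrDl.
have pu : p < gauss_cdf (t + e) by rewrite -tp gauss_cdf_incr// ltrDl.
near=> q.
have ql : gauss_cdf (t - e) < q by near: q; exact: lt_nbhsr.
have qu : q < gauss_cdf (t + e) by near: q; exact: lt_nbhsl.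
have q01 : 0 < q < 1.
  by rewrite (lt_trans _ ql) ?gauss_cdf_gt0// (lt_trans qu) ?gauss_cdf_lt1.
have qK := gauss_quantileK q01.
rewrite ltr_norml; apply/andP; split.
  have : gauss_quantile q < t + e; last lra.
  rewrite ltNge; apply/negP; rewrite le_eqVlt => /orP[/eqP E|/gauss_cdf_incr].
    by move: qu; rewrite E qK ltxx.
  by rewrite qK ltNge (ltW qu).
have : t - e < gauss_quantile q; last lra.
rewrite ltNge; apply/negP; rewrite le_eqVlt => /orP[/eqP E|/gauss_cdf_incr].
  by move: ql; rewrite -E qK ltxx.
by rewrite qK ltNge (ltW ql).
Unshelve. all: by end_near. Qed.

Lemma cvg_dotv (T : Type) (F : set_system T) (FF : Filter F)
    (f g : T -> 'cV[R]_n) (x y : 'cV[R]_n) :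
  (forall k, f t k ord0 @[t --> F] --> x k ord0) ->
  (forall k, g t k ord0 @[t --> F] --> y k ord0) ->
  dotv (f t) (g t) @[t --> F] --> dotv x y.
Proof.
move=> fx gy; under eq_fun do rewrite dotvE; rewrite dotvE.
by apply: cvg_sumr => k; apply: cvgM.
Qed.

Section coordinate_filter.
Context (F : set_system 'cV[R]_n) (FF : Filter F) (y : 'cV[R]_n).
Hypothesis Fy : forall k, x k ord0 @[x --> F] --> y k ord0.

Lemma cvg_slab_gauss i : 0 < slab_pos u a i y < 1 ->
  slab_gauss u a i x @[x --> F] --> slab_gauss u a i y.
Proof.
move=> /andP[p0 p1]; apply: cvg_comp (cvg_gauss_quantile p0 p1).
apply: cvgB; last exact: cvg_cst.
by apply: cvg_dotv => // k; exact: cvg_cst.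
Qed.

(** The slack of [ln_frame_det] at the point [y]. *)
Definition frame_gain y : R :=
  ln (\det (transport_diff c u a y)) - \sum_i c i * ln (gauss (slab_gauss u a i y))^-1.

Lemma cvg_frame_gain : (forall i, 0 < slab_pos u a i y < 1) ->
  frame_gain x @[x --> F] --> frame_gain y.
Proof.
move=> y01.
have gV i : (gauss (slab_gauss u a i x))^-1 @[x --> F] --> (gauss (slab_gauss u a i y))^-1.
  apply: cvgV; first by rewrite gt_eqF// gauss_gt0.
  by apply: cvg_comp (cvg_slab_gauss (y01 i)) _; exact: continuous_gauss.
apply: cvgB.
  apply: (cvg_comp (fun x => \det (transport_diff c u a x))); last first.
    by apply: continuous_ln; exact: transport_diff_det_gt0.
  apply: cvg_det => k l; rewrite /transport_diff /frame_mx summxE.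
  under eq_fun do rewrite summxE.
  apply: cvg_sumr => i; rewrite mxE; under eq_fun do rewrite mxE.
  by apply: cvgM; [apply: cvgM; [exact: cvg_cst|exact: gV]|exact: cvg_cst].
apply: cvg_sumr => i; apply: cvgM; first exact: cvg_cst.
apply: (cvg_comp (fun x => (gauss (slab_gauss u a i x))^-1)); first exact: gV.
by apply: continuous_ln; rewrite invr_gt0 gauss_gt0.
Qed.

End coordinate_filter.

Lemma slab_pos_shift i y v : slab_pos u a i (y + v) = slab_pos u a i y + dotv (u i) v.
Proof. by rewrite /slab_pos dotvDr addrAC. Qed.

Lemma slab_body_shift r s y v : slab_body u a r y ->
  (forall i, `|dotv (u i) v| <= s) -> slab_body u a (r - s) (y + v).
Proof.
move=> yr vs i; have /andP[? ?] := yr i; have := vs i.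
by rewrite slab_pos_shift ler_norml => /andP[? ?]; apply/andP; split; lra.
Qed.

(** By continuity the gain exceeds half its value at [y] on a small cube [B], where th = exp(gain /
    2) is admissible. The positive term (1 - 1/th) vol(B) makes the volume bound strict. *)
Lemma slab_volume_lt1_of_gain rho y : 0 < rho -> slab_body u a rho y ->
  0 < frame_gain y -> (volume (slab_body u a 0) < 1)%E.
Proof.
move=> rho0 yrho gain.
have y01 i : 0 < slab_pos u a i y < 1.
  by have /andP[? ?] := yrho i; apply/andP; split; lra.
have C := cvg_frame_gain (nbhs_filter y) (fun k => @coord_continuous _ _ _ k ord0 y) y01.
have gain2 : frame_gain y / 2 < frame_gain y by rewrite ltr_pdivrMr// ltr_pMr// ltr1n.
have /nbhs_ballP[e0 /= e00 He0] := @cvgr_gt _ _ _ (nbhs_filter y) _ _ C _ gain2.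
(* The first bound keeps the cube in the neighbourhood just found; the second keeps it in the body
   shrunk by [rho / 2], as slab coordinates change by at most n e. *)
pose e := Num.min (e0 / 2) (rho / (2 * (n%:R + 1))).
have n10 : 0 < n%:R + 1 :> R by rewrite ltr_wpDl.
have e_gt0 : 0 < e by rewrite lt_min !divr_gt0// mulr_gt0.
have e_lt : e < e0 by rewrite gt_min ltr_pdivrMr// ltr_pMr// ltr1n.
have ne : n%:R * e <= rho / 2.
  have : e * (2 * (n%:R + 1)) <= rho.
    by rewrite -ler_pdivlMr ?mulr_gt0// ge_min lexx orbT.
  have : 0 <= n%:R :> R by [].
  by move: (n%:R) => m ? ?; nra.
pose B := cube (y - const_mx e) (2 * e).
have Bcoord x : B x -> forall k, `|(x - y) k ord0| <= e.
  move=> Bx k; have := Bx k; rewrite !mxE ler_norml => /andP[? ?].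
  by apply/andP; split; lra.
have uc i k : `|u i k ord0| <= 1.
  by rewrite -ler_sqr ?nnegrE// expr1n real_normK ?num_real// -(u1 i) sqr_coord_le_dotv.
have Br : B `<=` slab_body u a (rho / 2).
  move=> x Bx; rewrite (_ : rho / 2 = rho - rho / 2); last by field.
  rewrite -(subrKC y x); apply: slab_body_shift => // i.
  rewrite dotvE; apply: le_trans (ler_norm_sum _ _ _) _; apply: le_trans ne.
  rewrite -[n in n%:R]card_ord mulr_natl -sumr_const; apply: ler_sum => k _.
  by rewrite normrM -[leRHS]mul1r ler_pM//; exact: Bcoord.
have th1 : 1 <= expR (frame_gain y / 2) by rewrite -expR0 ler_expR divr_ge0// ltW.
have thB x : B x -> ln (expR (frame_gain y / 2)) +
    \sum_i c i * ln (gauss (slab_gauss u a i x))^-1 <= ln (\det (transport_diff c u a x)).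
  move=> Bx; rewrite expRK -lerBrDr; apply/ltW/He0.
  rewrite mx_norm_ball /ball_/= distrC [ltLHS]mx_normrE; apply/bigmax_ltP.
  by split => // -[k l] _ /=; rewrite ord1 (le_lt_trans (Bcoord _ Bx k)).
have rho2 : 0 < rho / 2 by rewrite divr_gt0.
have := slab_volume0 rho0 yrho rho2 th1 (meas_cube _ _) Br thB.
rewrite volume_cube; last by rewrite mulr_ge0// ltW.
rewrite -EFinM => H.
have pos : 0 < (1 - (expR (frame_gain y / 2))^-1) * (2 * e) ^+ n.
  rewrite mulr_gt0 ?exprn_gt0 ?mulr_gt0// subr_gt0 invf_lt1 ?expR_gt0//.
  by rewrite -expR0 ltr_expR divr_gt0.
move: (volume_ge0 (slab_body u a 0)) H.
case: (volume _) => [x _|//|//]; rewrite -EFinD lee_fin lte_fin.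
by apply: lt_le_trans; rewrite ltrDl.
Qed.

Lemma slab_volume_lt1 i j rho y : 0 < rho -> slab_body u a rho y ->
  0 < c i -> 0 < c j -> dotv (u i) (u j) != 0 -> dotv (u i) (u j) ^+ 2 != 1 ->
  (volume (slab_body u a 0) < 1)%E.
Proof.
move=> rho0 yrho ci cj uij0 uij1.
pose g l y := gauss (slab_gauss u a l y).
have [y1 y1r gne] : exists2 y1, slab_body u a (rho / 2) y1 & g i y1 != g j y1.
  (* [v] is the component of [u j] orthogonal to [u i]: moving along it changes the j-th slab
     coordinate and fixes the i-th. *)
  pose b := dotv (u i) (u j); pose v := u j - b *: u i.
  have b1 : b ^+ 2 < 1.
    by rewrite lt_neqAle uij1 (le_trans (dotv_CS _ _))// !u1 mulr1.
  have iv : dotv (u i) v = 0 by rewrite dotvBr dotvZr u1 mulr1 subrr.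
  have jv : dotv (u j) v = 1 - b ^+ 2 by rewrite dotvBr dotvZr u1 dotvC expr2.
  have vv : dotv v v = 1 - b ^+ 2 by rewrite {1}/v dotvBl dotvZl jv iv mulr0 subr0.
  have lv l : `|dotv (u l) v| <= 1.
    rewrite -ler_sqr ?nnegrE// expr1n real_normK ?num_real//.
    by rewrite (le_trans (dotv_CS _ _))// u1 mul1r vv gerBl sqr_ge0.
  pose pt (m : nat) := y + (m%:R * (rho / 4)) *: v.
  have ptr m : (m <= 2)%N -> slab_body u a (rho / 2) (pt m).
    move=> m2; rewrite (_ : rho / 2 = rho - rho / 2); last by field.
    apply: slab_body_shift => // l; rewrite dotvZr normrM.
    have r4 : 0 <= m%:R * (rho / 4) by rewrite mulr_ge0// divr_ge0// ltW.
    rewrite (ger0_norm r4) -[leRHS]mulr1 ler_pM//.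
    rewrite (_ : rho / 2 = 2 * (rho / 4)); last by field.
    by rewrite ler_wpM2r ?divr_ge0 ?(ltW rho0)// ler_nat.
  have gi m : g i (pt m) = g i y.
    by rewrite /g /slab_gauss slab_pos_shift dotvZr iv mulr0 addr0.
  have pj m : slab_pos u a j (pt m) = slab_pos u a j y + m%:R * (rho / 4) * (1 - b ^+ 2).
    by rewrite slab_pos_shift dotvZr jv.
  (* Along [v] the i-th Gaussian coordinate is constant and the j-th one is
     strictly monotone, so that [gauss] takes the same value there at most
     twice: among three points, one separates the two densities. *)
  have incr m1 m2 : (m1 < m2 <= 2)%N -> slab_gauss u a j (pt m1) != slab_gauss u a j (pt m2).
    move=> /andP[m12 m22]; apply/eqP => E.
    have r20 : 0 < rho / 2 by rewrite divr_gt0.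
    have := congr1 gauss_cdf E.
    have h1 := ptr m1 (leq_trans (ltnW m12) m22).
    rewrite (slab_gaussK r20 _ h1) (slab_gaussK r20 _ (ptr m2 m22)) !pj.
    move/addrI; apply/eqP; rewrite lt_eqF// ltr_pM2r ?subr_gt0//.
    by rewrite ltr_pM2r ?divr_gt0// ltr_nat.
  apply: contrapT => H.
  have all m : (m <= 2)%N -> g j (pt m) = g i y.
    move=> m2; apply/eqP; apply: contrapT => /negP ne; apply: H.
    by exists (pt m); [exact: ptr|rewrite gi eq_sym].
  have sq m1 m2 : (m1 <= 2)%N -> (m2 <= 2)%N ->
      slab_gauss u a j (pt m1) ^+ 2 = slab_gauss u a j (pt m2) ^+ 2.
    by move=> h1 h2; exact: gauss_eq_sqr (etrans (all _ h1) (esym (all _ h2))).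
  have := sq 0%N 1%N isT isT; have := sq 0%N 2%N isT isT.
  move/eqP; rewrite eqf_sqr (negPf (incr 0%N 2%N _))//= => /eqP E2.
  move/eqP; rewrite eqf_sqr (negPf (incr 0%N 1%N _))//= => /eqP E1.
  have := incr 1%N 2%N isT; rewrite -[X in X != _]opprK -E1 E2 opprK eqxx.
  by [].
apply: (slab_volume_lt1_of_gain (divr_gt0 rho0 _) y1r) => //.
rewrite subr_gt0; apply: (ln_frame_det_lt c0 u1 cu1 _ ci cj uij0).
  by move=> l; rewrite invr_gt0 gauss_gt0.
by apply: contra gne => /eqP/invr_inj E; rewrite /g E.
Qed.

End slab.

(** * The equality case *)

Lemma unit_cubeP (R : realType) n (y : 'cV[R]_n) :
  cube 0 1 y <-> forall k, 0 <= y k ord0 <= 1.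
Proof. by split=> H k; have := H k; rewrite mxE add0r. Qed.

Section equality_case.
Context {R : realType} {n N : nat}.
Variables (c : 'I_N -> R) (u : 'I_N -> 'cV[R]_n) (a : 'I_N -> R).
Hypotheses (c0 : forall i, 0 <= c i) (u1 : forall i, dotv (u i) (u i) = 1).
Hypothesis (cu1 : frame_mx c u (fun=> 1) = 1%:M).
Variables (K : set 'cV[R]_n) (rho : R) (y0 : 'cV[R]_n).
Hypotheses (rho0 : 0 < rho) (y0rho : slab_body u a rho y0).
Hypotheses (cK : closed K) (Kslab : K `<=` slab_body u a 0).

Lemma volume_sub_slab_le1 : (volume K <= 1)%E.
Proof.
have m0 : meas (set0 : set 'cV[R]_n) by rewrite /meas preimage_set0.
have := slab_volume0 c0 u1 cu1 rho0 y0rho rho0 (lexx 1) m0 (@sub0set _ _).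
rewrite invr1 subrr mul0e adde0 => H; apply: le_trans (H _) => //.
by apply: le_volume => //; [exact: closed_meas|exact: meas_slab_body].
Qed.

Definition pairwise_orth (J : {set 'I_N}) : bool :=
  [forall i in J, 0 < c i] &&
  [forall i in J, forall j in J, (i != j) ==> (dotv (u i) (u j) == 0)].

Lemma bessel (J : {set 'I_N}) x : pairwise_orth J ->
  \sum_(j in J) dotv (u j) x ^+ 2 <= dotv x x.
Proof.
move=> /andP[_ /forall_inP orth].
pose z := \sum_(j in J) dotv (u j) x *: u j.
have sumd y : dotv z y = \sum_(j in J) dotv (u j) x * dotv (u j) y.
  rewrite /z big_mkcond dotv_suml [RHS]big_mkcond; apply: eq_bigr => j _.
  by case: ifP; rewrite ?dotv0l ?dotvZl.
have zx : dotv z x = \sum_(j in J) dotv (u j) x ^+ 2.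
  by rewrite sumd; apply: eq_bigr => j _; rewrite expr2.
have zu j : j \in J -> dotv z (u j) = dotv (u j) x.
  move=> jJ; rewrite sumd (bigD1 j)//= u1 mulr1 big1 ?addr0// => i /andP[iJ ij].
  by have /forall_inP/(_ j jJ)/implyP/(_ ij)/eqP -> := orth i iJ; rewrite mulr0.
have zz : dotv z z = dotv z x.
  rewrite [LHS]sumd [RHS]sumd; apply: eq_bigr => j jJ; congr (_ * _).
  by rewrite dotvC zu.
by have := dotv_ge0 (x - z); rewrite dotvBl !dotvBr zz (dotvC x z) zx; lra.
Qed.

(** At equality, directions of positive weight are pairwise parallel or orthogonal, so a maximal
    orthogonal family contains each of them up to sign. *)
Lemma orth_basis : volume K = 1%E -> exists J, pairwise_orth J /\ #|J| = n.
Proof.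
move=> K1.
have dich i j : 0 < c i -> 0 < c j -> dotv (u i) (u j) != 0 -> dotv (u i) (u j) ^+ 2 = 1.
  move=> ci cj uij; apply/eqP; apply: contraT => uij1.
  have := slab_volume_lt1 c0 u1 cu1 rho0 y0rho ci cj uij uij1.
  rewrite ltNge -K1 le_volume//; first exact: closed_meas.
  exact: meas_slab_body.
have [J /maxsetP[JP Jmax]] : {J | maxset pairwise_orth J}.
  apply: ex_maxset; exists finset.set0; apply/andP; split; apply/forall_inP => i;
    by rewrite inE.
exists J; split => //.
have Jc i : i \in J -> 0 < c i by move: JP => /andP[/forall_inP + _]; exact.
have hit i : 0 < c i -> exists2 j, j \in J & dotv (u i) (u j) != 0.
  move=> ci; apply/exists_inP; apply: contraT.
  rewrite negb_exists_in => /forall_inP no.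
  have iJ : i \in J.
    suff <- : (i |: J)%SET = J by rewrite !inE eqxx.
    apply: Jmax; last exact: finset.subsetUr.
    move: JP => /andP[/forall_inP cJ /forall_inP oJ].
    apply/andP; split; apply/forall_inP => k; rewrite !inE => /orP[/eqP ->|kJ] //.
    - exact: cJ.
    - apply/forall_inP => l; rewrite !inE => /orP[/eqP ->|lJ]; first by rewrite eqxx.
      by have := no l lJ; rewrite negbK => ->; rewrite implybT.
    - apply/forall_inP => l; rewrite !inE => /orP[/eqP ->|lJ].
        by have := no k kJ; rewrite negbK dotvC => ->; rewrite implybT.
      by have /forall_inP := oJ k kJ; apply.
  by have := no i iJ; rewrite u1 oner_eq0.
have one i : 0 < c i -> \sum_(j in J) dotv (u j) (u i) ^+ 2 = 1.
  move=> ci; apply/eqP; rewrite eq_le -{1}(u1 i) bessel//=.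
  have [j jJ uij] := hit i ci.
  rewrite (bigD1 j)//= dotvC (dich _ _ ci (Jc j jJ) uij) lerDl sumr_ge0// => k _.
  exact: sqr_ge0.
(* By Parseval [sum_i c_i (u_i . u_j)^2 = 1] for each j in J, and by [one] the sum
   over j in J of the same squares is 1 for each i: sum over both indices. *)
have : (#|J|%:R : R) = n%:R.
  rewrite -(frame_trace cu1 u1) -sum1_card natr_sum.
  transitivity (\sum_(j in J) \sum_i c i * dotv (u j) (u i) ^+ 2).
    apply: eq_bigr => j _; rewrite -(u1 j) -(frame_parseval cu1).
    by apply: eq_bigr => i _; rewrite (dotvC (u j)) expr2.
  rewrite exchange_big /=; apply: eq_bigr => i _; rewrite -mulr_sumr.
  have := c0 i; rewrite le_eqVlt => /orP[/eqP <-|ci]; first by rewrite mul0r.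
  by rewrite one// mulr1.
by move/eqP; rewrite eqr_nat => /eqP.
Qed.

Lemma orth_mx : volume K = 1%E -> exists (W : 'M[R]_n) (b : 'cV[R]_n),
  W *m W^T = 1%:M /\ K `<=` [set x | cube 0 1 (W *m x + b)].
Proof.
move=> /orth_basis[J [JP Jn]].
pose e (k : 'I_n) : 'I_N := enum_val (cast_ord (esym Jn) k).
have eJ k : e k \in J by exact: enum_valP.
have einj : injective e by move=> k l /enum_val_inj/cast_ord_inj.
pose W : 'M[R]_n := \matrix_(k, l) u (e k) l ord0.
have WE x k : (W *m x) k ord0 = dotv (u (e k)) x.
  by rewrite dotvE mxE; apply: eq_bigr => l _; rewrite mxE.
exists W, (- \col_k a (e k)); split.
  apply/matrixP => k l; rewrite !mxE.
  transitivity (dotv (u (e k)) (u (e l))).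
    by rewrite dotvE; apply: eq_bigr => p _; rewrite !mxE.
  have [->|kl] := eqVneq k l; first by rewrite u1.
  move: JP => /andP[_ /forall_inP/(_ _ (eJ k))/forall_inP/(_ _ (eJ l))/implyP].
  by rewrite (inj_eq einj) => /(_ kl)/eqP.
move=> x /Kslab xs; apply/unit_cubeP => k; have := xs (e k).
have -> : (W *m x + - \col_l a (e l)) k ord0 = slab_pos u a (e k) x.
  by rewrite [LHS]mxE WE !mxE.
by rewrite subr0.
Qed.

End equality_case.

(** * Closed subsets of full volume in a rotated unit cube *)

Section box.
Context {R : realType} {n : nat}.
Variables (W : 'M[R]_n) (b : 'cV[R]_n).
Hypothesis (WW : W *m W^T = 1%:M).
Let box := [set x : 'cV[R]_n | cube 0 1 (W *m x + b)].

Lemma orth_unitmx : W \in unitmx. Proof. by have [] := mulmx1_unit WW. Qed.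

Lemma orth_normr_det : `|\det W| = 1.
Proof.
have := congr1 determinant WW; rewrite det_mulmx det_tr det1 -expr2 => /eqP.
by rewrite sqrf_eq1 => /orP[] /eqP ->; rewrite ?normrN normr1.
Qed.

Lemma orth_coord_le1 k l : `|W k l| <= 1.
Proof.
rewrite -ler_sqr ?nnegrE// expr1n real_normK ?num_real//.
have <- : \sum_j W k j * W^T j k = 1.
  by have := congr1 (fun A : 'M[R]_n => A k k) WW; rewrite !mxE eqxx.
rewrite (bigD1 l)//= mxE -expr2 lerDl sumr_ge0// => j _.
by rewrite mxE -expr2 sqr_ge0.
Qed.

Lemma volume_orth_cube z s : 0 <= s ->
  volume [set x : 'cV[R]_n | cube z s (W *m x + b)] = (s ^+ n)%:E.
Proof.
move=> s0; rewrite volume_affine ?orth_unitmx//; last exact: meas_cube.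
by rewrite orth_normr_det invr1 mul1e volume_cube.
Qed.

(** Near a point of the box outside [K] there is a small cube [Y] in the box and disjoint from [K];
    its volume would push the total above 1. *)
Lemma closed_full_volume K : closed K -> K `<=` box -> volume K = 1%E -> K = box.
Proof.
move=> cK Kbox K1; apply/seteqP; split => // x bx; apply: contrapT => nKx.
have [e /= e0 He] : nbhs_ball x (~` K).
  by apply/nbhs_ballP; apply: open_nbhs_nbhs; split => //; exact/closed_openC.
pose s := Num.min 2^-1 (e / (n%:R + 1)).
have n10 : 0 < n%:R + 1 :> R by rewrite ltr_wpDl.
have s0 : 0 < s by rewrite lt_min invr_gt0 ltr0n divr_gt0.
have s1 : s <= 2^-1 by rewrite ge_min lexx.
have ns : n%:R * s < e.
  have : s * (n%:R + 1) <= e by rewrite -ler_pdivlMr// ge_min lexx orbT.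
  by move: (n%:R) => m; nra.
pose p := W *m x + b.
(* From each coordinate of [p] the small cube extends upwards if that coordinate is at most 1/2 and
   downwards otherwise; as s <= 1/2, it stays in the unit cube. *)
pose z : 'cV[R]_n := \col_k (if p k ord0 <= 2^-1 then p k ord0 else p k ord0 - s).
pose Y := [set y : 'cV[R]_n | cube z s (W *m y + b)].
have mY : meas Y by exact: (meas_affine _ _ (meas_cube _ _)).
have KY : K `&` Y = set0.
  apply/seteqP; split => // y [Ky Yy]; apply: (He y) Ky.
  rewrite mx_norm_ball /ball_/= distrC [ltLHS]mx_normrE; apply/bigmax_ltP.
  split => // -[k l] _ /=; rewrite ord1; apply: le_lt_trans ns.
  have -> : y - x = W^T *m (W *m (y - x)) by rewrite mulmxA (mulmx1C WW) mul1mx.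
  rewrite mxE; apply: le_trans (ler_norm_sum _ _ _) _.
  rewrite -[n in n%:R]card_ord mulr_natl -sumr_const; apply: ler_sum => j _.
  rewrite mxE normrM -[leRHS]mul1r ler_pM ?orth_coord_le1//.
  have -> : (W *m (y - x)) j ord0 = (W *m y + b) j ord0 - p j ord0.
    by rewrite /p mulmxBr !mxE; ring.
  have := Yy j; rewrite [z _ _]mxE; move: (p j ord0) ((W *m y + b) j ord0) => q w.
  by rewrite ler_norml; case: ifP => _ /andP[? ?]; apply/andP; split; lra.
have Ybox : Y `<=` box.
  move=> y Yy; apply/unit_cubeP => k; have := Yy k; rewrite [z _ _]mxE.
  have /unit_cubeP/(_ k) := bx; rewrite -/p.
  move: (p k ord0) ((W *m y + b) k ord0) => q w.
  by case: ifPn => [|/negbTE/negbT]; rewrite -?ltNge => ? /andP[? ?] /andP[? ?];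
    apply/andP; split; lra.
have mK := closed_meas cK.
have : (volume (K `|` Y) <= volume box)%E.
  apply: le_volume; last by move=> t [/Kbox//|/Ybox].
    by rewrite /meas preimage_setU; exact: measurableU.
  exact: (meas_affine _ _ (meas_cube _ _)).
rewrite volumeU_disj// K1 !volume_orth_cube//; last exact: ltW.
by rewrite expr1n -EFinD lee_fin leNgt ltrDl exprn_gt0.
Qed.

Lemma box_is_cube : is_cube box.
Proof.
have WtW := mulmx1C WW.
exists W^T, 2^-1, (W^T *m (const_mx 2^-1 - b)); split => //.
  by rewrite /orthogonal_mx trmxK.
have E x : W *m (2^-1 *: (W^T *m x) + W^T *m (const_mx 2^-1 - b)) + b =
    2^-1 *: x + const_mx 2^-1.
  by rewrite mulmxDr -scalemxAr !mulmxA WW !mul1mx addrA subrK.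
apply/seteqP; split => y /=.
  move=> /unit_cubeP yb; exists (2 *: (W *m y + b - const_mx 2^-1)).
    move=> k; have := yb k; rewrite [X in _ -> `|X| <= _]mxE [X in _ -> `|_ * X| <= _]mxE.
    rewrite [X in _ -> `|_ * (_ + X)| <= _]mxE [X in _ -> `|_ * (_ + - X)| <= _]mxE.
    move: ((W *m y + b) k ord0) => w /andP[? ?].
    by rewrite ler_norml; apply/andP; split; lra.
  rewrite -scalemxAr scalerA mulVf// scale1r -mulmxDr addrA subrK addrK.
  by rewrite mulmxA WtW mul1mx.
move=> [x xc <-]; apply/unit_cubeP => k; rewrite E !mxE.
by have := xc k; rewrite ler_norml => /andP[? ?]; apply/andP; split; lra.
Qed.

End box.

(** * Cubes *)

Section cube_quotient.
Context {R : realType} {n : nat}.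
Variables (Q : 'M[R]_n) (c : R) (t : 'cV[R]_n).
Hypotheses (QQ : Q *m Q^T = 1%:M) (c0 : 0 < c).
Let K : set 'cV[R]_n := [set c *: (Q *m x) + t | x in std_cube].

Lemma volume_cube_image : volume K = ((2 * c) ^+ n)%:E.
Proof.
have QtQ : Q^T *m Q = 1%:M by exact: mulmx1C.
have -> : K = [set y | cube (const_mx (- c)) (2 * c) (Q^T *m y + (- (Q^T *m t)))].
  apply/seteqP; split => y.
    move=> [x xc <-] k /=.
    have -> : Q^T *m (c *: (Q *m x) + t) - Q^T *m t = c *: x.
      by rewrite mulmxDr addrK -scalemxAr mulmxA QtQ mul1mx.
    have := xc k; rewrite !mxE; move: (x k ord0) => w.
    rewrite ler_norml => /andP[w1 w2].
    have h1 : 0 <= c * (1 - w) by rewrite mulr_ge0 ?(ltW c0)// subr_ge0.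
    have h2 : 0 <= c * (w + 1) by rewrite mulr_ge0 ?(ltW c0)//; lra.
    by apply/andP; split; lra.
  move=> yc; exists (c^-1 *: (Q^T *m y - Q^T *m t)).
    move=> k; have := yc k; rewrite [const_mx _ _ _]mxE.
    rewrite [X in _ -> `|X| <= _]mxE.
    move: ((Q^T *m y - Q^T *m t) k ord0) => w /andP[w1 w2].
    rewrite normrM gtr0_norm ?invr_gt0// ler_pdivrMl// mulr1 ler_norml.
    by apply/andP; split; lra.
  rewrite -scalemxAr scalerA divff ?gt_eqF// scale1r -mulmxBr mulmxA QQ mul1mx.
  exact: subrK.
have QtQ' : Q^T *m Q^T^T = 1%:M by rewrite trmxK.
by rewrite (volume_orth_cube _ QtQ')// mulr_ge0// ltW.
Qed.

Let l1 (w : 'cV[R]_n) : R := \sum_i `|w i ord0|.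

Lemma support_cube u : support_fun K u = c * l1 (Q^T *m u) + dotv t u.
Proof.
have val x : dotv (c *: (Q *m x) + t) u = c * dotv x (Q^T *m u) + dotv t u.
  by rewrite dotvDl dotvZl dotv_mulmx.
have ub x : std_cube x -> dotv x (Q^T *m u) <= l1 (Q^T *m u).
  move=> xc; rewrite dotvE; apply: ler_sum => i _.
  apply: le_trans (ler_norm _) _; rewrite normrM ler_piMl//; exact: xc.
pose xs : 'cV[R]_n := \col_i Num.sg ((Q^T *m u) i ord0).
have xsc : std_cube xs.
  by move=> i; rewrite mxE normr_sg; case: (_ != _); rewrite ?lexx ?ler01.
have xsE : dotv xs (Q^T *m u) = l1 (Q^T *m u).
  by rewrite dotvE; apply: eq_bigr => i _; rewrite mxE -normrEsg.
apply/eqP; rewrite eq_le; apply/andP; split.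
  apply: ge_sup.
    by exists (dotv (c *: (Q *m xs) + t) u), (c *: (Q *m xs) + t) => //; exists xs.
  by move=> _ [_ [x xc <-] <-]; rewrite val lerD2r ler_pM2l// ub.
rewrite -xsE -val; apply: ub_le_sup.
  exists (c * l1 (Q^T *m u) + dotv t u) => _ [_ [x xc <-] <-].
  by rewrite val lerD2r ler_pM2l// ub.
by exists (c *: (Q *m xs) + t) => //; exists xs.
Qed.

(** A unit vector has l1 norm at least 1, with equality on a coordinate axis, which [Q] carries to a
    direction of minimal width. *)
Lemma width_cube : (0 < n)%N -> width K = 2 * c.
Proof.
move=> n0.
have N u : support_fun K u + support_fun K (- u) = 2 * c * l1 (Q^T *m u).
  rewrite !support_cube dotvNr mulmxN /l1.
  under [X in c * X + - _]eq_bigr do rewrite mxE normrN.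
  by ring.
have lb u : unit_sphere u -> 2 * c <= support_fun K u + support_fun K (- u).
  move=> u1; rewrite N ler_peMr ?mulr_ge0 ?(ltW c0)//.
  have w1 : dotv (Q^T *m u) (Q^T *m u) = 1.
    by rewrite dotv_mulmx trmxK mulmxA QQ mul1mx.
  rewrite -w1 dotvE; apply: ler_sum => i _.
  rewrite -expr2 -(real_normK (num_real _)) expr2 ler_piMl//.
  by rewrite -ler_sqr ?nnegrE// expr1n real_normK ?num_real// -w1 sqr_coord_le_dotv.
pose e : 'cV[R]_n := delta_mx (Ordinal n0) ord0.
have QtQ : Q^T *m Q = 1%:M by exact: mulmx1C.
have us : unit_sphere (Q *m e).
  rewrite /unit_sphere /= dotv_mulmx mulmxA QtQ mul1mx dotvE (bigD1 (Ordinal n0))//=.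
  rewrite !mxE !eqxx mulr1 big1 ?addr0// => i ij.
  by rewrite !mxE (negPf ij) mul0r.
have att : support_fun K (Q *m e) + support_fun K (- (Q *m e)) = 2 * c.
  rewrite N mulmxA QtQ mul1mx /l1 (bigD1 (Ordinal n0))//= !mxE !eqxx normr1.
  rewrite big1 ?addr0 ?mulr1// => i ij.
  by rewrite !mxE (negPf ij) normr0.
apply/eqP; rewrite eq_le; apply/andP; split.
  rewrite -att; apply: ge_inf; last by exists (Q *m e).
  by exists (2 * c) => _ [u u1 <-]; exact: lb.
apply: lb_le_inf; first by exists (2 * c), (Q *m e).
by move=> _ [u u1 <-]; exact: lb.
Qed.

End cube_quotient.

Lemma iwq_cube (R : realType) n (K : set 'cV[R]_n) : (0 < n)%N -> is_cube K -> iwq K = 1.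
Proof.
move=> n0 [Q [c [t [QQ c0 ->]]]].
rewrite /iwq volume_cube_image// width_cube//= divff// expf_neq0// gt_eqF//.
by rewrite mulr_gt0.
Qed.

(** * Widths and the extremal position *)

Definition dirwidth (R : realType) n (K : set 'cV[R]_n) u : R :=
  support_fun K u + support_fun K (- u).

Section support.
Context {R : realType} {n : nat}.
Variables (K : set 'cV[R]_n).
Hypotheses (cK : compact K) (K0 : K !=set0).

Lemma compact_coord_bound : exists2 M : R, 0 < M &
  forall x, K x -> forall i, `|x i ord0| <= M.
Proof.
have [M [_ HM]] := compact_bounded cK.
have M1 : M < Num.max M 0 + 1 by rewrite ltr_pwDr// le_max lexx.
exists (Num.max M 0 + 1); first by rewrite ltr_pwDr// le_max lexx orbT.
move=> x Kx i; apply: le_trans (HM _ M1 x Kx).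
rewrite [leRHS]mx_normrE; exact: (le_bigmax _ (fun ij => `|x ij.1 ij.2|) (i, ord0)).
Qed.

Lemma dotv_bound M (x u : 'cV[R]_n) : (forall i, `|x i ord0| <= M) ->
  `|dotv x u| <= M * \sum_i `|u i ord0|.
Proof.
move=> xM; rewrite dotvE mulr_sumr; apply: le_trans (ler_norm_sum _ _ _) _.
by apply: ler_sum => i _; rewrite normrM ler_wpM2r.
Qed.

Lemma has_sup_support u : has_sup [set dotv x u | x in K].
Proof.
have [M M0 HM] := compact_coord_bound.
split; first by have [x Kx] := K0; exists (dotv x u), x.
exists (M * \sum_i `|u i ord0|) => _ [x Kx <-].
exact: le_trans (ler_norm _) (dotv_bound _ (HM x Kx)).
Qed.

Lemma support_ub x u : K x -> dotv x u <= support_fun K u.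
Proof.
move=> Kx; apply: ub_le_sup; first by have [] := has_sup_support u.
by exists x.
Qed.

Lemma support_le u b : (forall x, K x -> dotv x u <= b) -> support_fun K u <= b.
Proof.
move=> H; apply: ge_sup; first by have [x Kx] := K0; exists (dotv x u), x.
by move=> _ [x Kx <-]; exact: H.
Qed.

Lemma dirwidth_ge x y u : K x -> K y -> dotv (x - y) u <= dirwidth K u.
Proof.
by move=> Kx Ky; rewrite dotvBl -dotvNr lerD// support_ub.
Qed.

Lemma dirwidth_ge0 u : 0 <= dirwidth K u.
Proof. by have [x Kx] := K0; rewrite -(dotv0l u) -(subrr x) dirwidth_ge. Qed.

Lemma supportZ s u : 0 < s -> support_fun K (s *: u) = s * support_fun K u.
Proof.
move=> s0; apply/eqP; rewrite eq_le; apply/andP; split.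
  by apply: support_le => x Kx; rewrite dotvZr ler_pM2l// support_ub.
rewrite -ler_pdivlMl//; apply: support_le => x Kx.
by rewrite ler_pdivlMl// -dotvZr support_ub.
Qed.

Lemma dirwidthZ s u : 0 < s -> dirwidth K (s *: u) = s * dirwidth K u.
Proof. by move=> s0; rewrite /dirwidth -scalerN !supportZ// mulrDr. Qed.

Lemma dirwidth_lipschitz : exists2 L : R, 0 < L &
  forall u v, `|dirwidth K u - dirwidth K v| <= L * \sum_i `|u i ord0 - v i ord0|.
Proof.
have [M M0 HM] := compact_coord_bound.
exists (2 * M); first by rewrite mulr_gt0.
have S u v : support_fun K u <= support_fun K v + M * \sum_i `|u i ord0 - v i ord0|.
  apply: support_le => x Kx; rewrite -[u](subrK v) dotvDr addrC lerD ?support_ub//.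
  apply: le_trans (ler_norm _) _; apply: le_trans (dotv_bound _ (HM x Kx)) _.
  rewrite ler_wpM2l ?(ltW M0)//; apply: ler_sum => i _.
  by rewrite !mxE addrNK.
have D u v : dirwidth K u <= dirwidth K v + 2 * M * \sum_i `|u i ord0 - v i ord0|.
  have h1 := S u v; have h2 := S (- u) (- v).
  have E : \sum_i `|(- u) i ord0 - (- v) i ord0| = \sum_i `|u i ord0 - v i ord0|.
    by apply: eq_bigr => i _; rewrite !mxE -opprD normrN.
  by rewrite E in h2; rewrite /dirwidth; move: (\sum_i _) h1 h2 => s h1 h2; lra.
move=> u v; rewrite ler_norml; apply/andP; split.
  have := D v u; under eq_bigr do rewrite distrC.
  by lra.
by have := D u v; lra.
Qed.

Lemma cvg_dirwidth (T : Type) (F : set_system T) (FF : Filter F)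
    (f : T -> 'cV[R]_n) (u : 'cV[R]_n) :
  (forall k, f t k ord0 @[t --> F] --> u k ord0) ->
  dirwidth K (f t) @[t --> F] --> dirwidth K u.
Proof.
move=> fu; have [L L0 HL] := dirwidth_lipschitz.
have S : L * \sum_i `|f t i ord0 - u i ord0| @[t --> F] --> L * \sum_i `|u i ord0 - u i ord0|.
  apply: cvgM; first exact: cvg_cst.
  apply: cvg_sumr => i; apply: cvg_norm; apply: cvgB; [exact: fu|exact: cvg_cst].
move: S; rewrite (_ : L * _ = 0); last first.
  by rewrite big1 ?mulr0// => i _; rewrite subrr normr0.
move=> /cvgrPdist_lt S; apply/cvgrPdist_lt => e e0.
move: (S e e0); apply: filterS => t; rewrite sub0r normrN ger0_norm; last first.
  by rewrite mulr_ge0 ?(ltW L0)// sumr_ge0.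
by rewrite distrC; apply: le_lt_trans; exact: HL.
Qed.

Lemma dirwidth_linear_image (A : 'M[R]_n) u :
  dirwidth (linear_image A K) u = dirwidth K (A^T *m u).
Proof.
have S v : support_fun (linear_image A K) v = support_fun K (A^T *m v).
  congr sup; apply/seteqP; split => z /=.
    by move=> [_ [x Kx <-] <-]; exists x => //; rewrite dotv_mulmx.
  by move=> [x Kx <-]; exists (A *m x); [exists x|rewrite dotv_mulmx].
by rewrite /dirwidth !S mulmxN.
Qed.

(** For v = (e / (2 |u|)) u the points x0 + v and x0 - v stay in the sup-norm ball of radius [e], so
    the width at [u] is at least 2 v.u = e |u|. *)
Lemma dirwidth_lower x0 : K° x0 -> exists2 r : R, 0 < r &
  forall u, r ^+ 2 * dotv u u <= dirwidth K u ^+ 2.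
Proof.
move=> /nbhs_ballP[e /= e0 He].
exists (e / 2); first by rewrite divr_gt0.
move=> u; have [->|u0] := eqVneq u 0; first by rewrite dotv0l mulr0 sqr_ge0.
have uu : 0 < dotv u u by rewrite lt_def dotv_ge0 dotv_eq0 u0.
pose w := Num.sqrt (dotv u u); have w0 : 0 < w by rewrite sqrtr_gt0.
have w2 : w ^+ 2 = dotv u u by rewrite sqr_sqrtr// ltW.
have uw i : `|u i ord0| <= w.
  rewrite -ler_sqr ?nnegrE ?(ltW w0)// real_normK ?num_real// w2.
  exact: sqr_coord_le_dotv.
pose s := e / (2 * w); have s0 : 0 < s by rewrite divr_gt0// mulr_gt0.
have sw : s * w = e / 2 by rewrite /s; field; rewrite gt_eqF.
have KK v : (v = s *: u \/ v = - (s *: u)) -> K (x0 + v).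
  move=> vE; apply: He; rewrite mx_norm_ball /ball_/= opprD addNKr normrN.
  have -> : `|v| = `|s *: u| by case: vE => ->; rewrite ?normrN.
  rewrite [ltLHS]mx_normrE; apply/bigmax_ltP; split => // -[k l] _ /=.
  rewrite ord1 mxE normrM gtr0_norm//.
  apply: (@le_lt_trans _ _ (e / 2)); first by rewrite -sw ler_wpM2l// ltW.
  by rewrite ltr_pdivrMr// ltr_pMr// ltr1n.
have := dirwidth_ge u (KK _ (or_introl erefl)) (KK _ (or_intror erefl)).
rewrite opprD addrACA subrr add0r opprK dotvDl dotvZl -w2 => H.
rewrite -exprMn ler_sqr ?nnegrE ?mulr_ge0 ?dirwidth_ge0 ?divr_ge0 ?(ltW e0) ?(ltW w0)//.
apply: le_trans H; rewrite expr2 mulrA sw.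
have : 0 <= e / 2 * w by rewrite mulr_ge0 ?divr_ge0 ?(ltW e0) ?(ltW w0).
lra.
Qed.

End support.

Section matrix_compact.
Context {R : realType} {m n : nat}.

Lemma cvg_matrix (T : Type) (F : set_system T) (FF : Filter F)
    (f : T -> 'M[R]_(m, n)) (A : 'M[R]_(m, n)) :
  (forall i j, f t i j @[t --> F] --> A i j) -> f @ F --> A.
Proof.
move=> fA; apply/cvgrPdist_lt => e e0.
have H : \forall t \near F, forall ij : 'I_m * 'I_n, `|A ij.1 ij.2 - f t ij.1 ij.2| < e.
  apply: filter_forall => -[i j].
  by have /cvgrPdist_lt := fA i j; exact.
move: H; apply: filterS => t H; rewrite [ltLHS]mx_normrE; apply/bigmax_ltP; split => // -[i j] _.
by have := H (i, j); rewrite !mxE.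
Qed.

Lemma compact_matrix (X : set 'M[R]_(m, n)) B : closed X ->
  (forall A, X A -> forall i j, `|A i j| <= B) -> compact X.
Proof.
move=> clX XB.
pose S := [set v : 'rV[R]_(m * n) | forall k, v ord0 k \in `[- B, B]].
have cS : compact S.
  apply: (@rV_compact _ _ (fun=> `[- B, B]%classic)) => k.
  exact: segment_compact.
have cf : continuous (@vec_mx R m n).
  move=> v; apply: (@cvg_matrix _ _ (nbhs_filter v)) => i j.
  by rewrite mxE; under eq_fun do rewrite mxE; exact: coord_continuous.
have cfS : compact (@vec_mx R m n @` S).
  by apply: continuous_compact => //; exact: continuous_subspaceT.
apply: (subclosed_compact clX cfS) => A XA.
exists (mxvec A); last exact: mxvecK.
move=> k; case/mxvec_indexP: k => i j.
by rewrite mxvecE in_itv /= -ler_norml; exact: XB.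
Qed.

End matrix_compact.

(** * Maximizing the determinant *)

Section extremal.
Context {R : realType}.

Lemma closed_sublevel (T : topologicalType) (f : T -> R) b :
  continuous f -> closed [set x | f x <= b].
Proof. by move=> /continuous_closedP/(_ _ (@closed_le R b)). Qed.

Lemma cvg_mulmx_col m n (T : Type) (F : set_system T) (FF : Filter F)
    (f : T -> 'M[R]_(m, n)) (g : T -> 'cV[R]_n) (A : 'M[R]_(m, n)) (v : 'cV[R]_n) :
  (forall i j, f t i j @[t --> F] --> A i j) ->
  (forall j, g t j ord0 @[t --> F] --> v j ord0) ->
  forall i, (f t *m g t) i ord0 @[t --> F] --> (A *m v) i ord0.
Proof.
move=> fA gv i; rewrite mxE; under eq_fun do rewrite mxE.
by apply: cvg_sumr => j; apply: cvgM; [exact: fA|exact: gv].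
Qed.

Lemma coord_cvg m n (A : 'M[R]_(m, n)) i j :
  (fun M : 'M[R]_(m, n) => M i j) t @[t --> nbhs A] --> A i j.
Proof. exact: coord_continuous. Qed.

(** The admissible matrices [BB] form a compact set, so the determinant has a maximizer [B]; it is
    invertible because [r%:M] is admissible with positive determinant. *)
Lemma extremal_position n (K : set 'cV[R]_n) : compact K -> K° !=set0 ->
  exists A : 'M[R]_n, [/\ A \in unitmx,
    forall u, dotv u u <= dirwidth (linear_image A K) u ^+ 2 &
    forall B : 'M[R]_n,
      (forall u, dotv (B *m u) (B *m u) <= dirwidth (linear_image A K) u ^+ 2) ->
      \det B <= 1].
Proof.
move=> cK [x0 Kx0]; have K0 : K !=set0 by exists x0; exact: interior_subset.
have [r r0 Hr] := dirwidth_lower cK K0 Kx0.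
pose BB := [set B : 'M[R]_n | forall v, dotv (B *m v) (B *m v) <= dirwidth K v ^+ 2].
have clBB : closed BB.
  rewrite (_ : BB = \bigcap_(v in setT)
      [set B : 'M[R]_n | dotv (B *m v) (B *m v) <= dirwidth K v ^+ 2]).
    apply: closed_bigI => v _; apply: closed_sublevel => B.
    have c k : (C *m v) k ord0 @[C --> nbhs B] --> (B *m v) k ord0.
      apply: (cvg_mulmx_col (nbhs_filter B)); first exact: coord_cvg.
      by move=> j; exact: cvg_cst.
    exact: (cvg_dotv (nbhs_filter B)).
  by apply/seteqP; split => [B HB v _|B HB v]; [exact: HB|exact: HB].
have dw0 v := dirwidth_ge0 cK K0 v.
have bBB B : BB B -> forall i j, `|B i j| <= \sum_k dirwidth K (delta_mx k ord0).
  move=> HB i j; apply: (@le_trans _ _ (dirwidth K (delta_mx j ord0))).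
    rewrite -ler_sqr ?nnegrE// real_normK ?num_real//.
    apply: le_trans (HB _); rewrite -colE; apply: le_trans (sqr_coord_le_dotv _ i).
    by rewrite mxE.
  by rewrite (bigD1 j)//= lerDl sumr_ge0.
have BBr : BB r%:M.
  by move=> v; rewrite mul_scalar_mx dotvZl dotvZr mulrA -expr2.
have [B] : exists2 B, B \in BB & forall C, C \in BB -> \det C <= \det B.
  apply: compact_EVT_max; [by exists r%:M|exact: compact_matrix bBB|].
  apply: continuous_subspaceT => B.
  by apply: (cvg_det (nbhs_filter B)) => i j; exact: coord_continuous.
rewrite inE => BBB Bmax.
have dB0 : 0 < \det B.
  by apply: lt_le_trans (Bmax r%:M _); rewrite ?inE// det_scalar exprn_gt0.
have uB : B \in unitmx by rewrite unitmxE unitfE gt_eqF.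
exists (invmx B)^T; split.
- by rewrite unitmx_tr unitmx_inv.
- move=> u; rewrite dirwidth_linear_image trmxK.
  by have := BBB (invmx B *m u); rewrite mulKVmx.
- move=> C HC; have : BB (C *m B).
    move=> v; have := HC (B *m v).
    by rewrite dirwidth_linear_image trmxK mulKmx// mulmxA.
  move=> H; have := Bmax (C *m B); rewrite inE => /(_ H).
  by rewrite det_mulmx ger_pMl.
Qed.

(** The expansion det(1 + e D) = 1 + e tr D + O(e^2), read off the characteristic polynomial of
    [- D] at 1/e; [S] controls the lower coefficients. *)
Lemma det_gt1_near1 n (D : 'M[R]_n) : 0 < \tr D ->
  exists2 e0, 0 < e0 & forall e, 0 < e -> e <= e0 -> 1 < \det (1%:M + e *: D).
Proof.
case: n D => [|n] D; first by rewrite /mxtrace big_ord0 ltxx.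
move=> t0; pose X := char_poly (- D).
pose S := \sum_(k < n) `|X`_k|; have S0 : 0 <= S by rewrite sumr_ge0.
have S10 : 0 < S + 1 by rewrite ltr_wpDl.
exists (Num.min 1 (\tr D / (S + 1) / 2)); first by rewrite lt_min ltr01 !divr_gt0.
move=> e e0; rewrite le_min => /andP[e1 eS].
have X_horner x : X.[x] = \det (x%:M + D).
  rewrite -horner_evalE -det_map_mx; congr determinant; apply/matrixP => i j.
  rewrite !mxE /= horner_evalE hornerD hornerN hornerMn hornerX hornerC.
  by rewrite opprK.
have E : \det (1%:M + e *: D) = e ^+ n.+1 * X.[e^-1].
  rewrite X_horner -detZ; congr determinant.
  by rewrite scalerDr scale_scalar_mx divff// gt_eqF.
have sX : size X = n.+2 by exact: size_char_poly.
have X_top : X`_n.+1 = 1.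
  by have /monicP := char_poly_monic (- D); rewrite lead_coefE -/X sX.
have X_tr : X`_n = \tr D by have := char_poly_trace (- D) isT; rewrite raddfN opprK.
have ene k : (k <= n.+1)%N -> e ^+ n.+1 * (e^-1) ^+ k = e ^+ (n.+1 - k).
  by move=> kn; rewrite exprVn expfB_cond ?gt_eqF//.
have rest : `|\sum_(k < n) X`_k * e ^+ (n.+1 - k)| <= S * e ^+ 2.
  rewrite mulr_suml; apply: le_trans (ler_norm_sum _ _ _) _; apply: ler_sum => k _.
  rewrite normrM ler_wpM2l// ger0_norm ?exprn_ge0 ?(ltW e0)//.
  by apply: ler_wiXn2l; rewrite ?(ltW e0)// ltn_subRL addnC; have := ltn_ord k; lia.
have -> : \det (1%:M + e *: D) =
    \sum_(k < n) X`_k * e ^+ (n.+1 - k) + \tr D * e + 1.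
  rewrite E horner_coef sX !big_ord_recr /= X_top X_tr mul1r !mulrDr; congr (_ + _ + _).
  - rewrite mulr_sumr; apply: eq_bigr => k _; rewrite mulrCA ene//.
    by rewrite ltnW// ltnS ltnW.
  - by rewrite mulrCA ene// subSnn expr1.
  - by rewrite ene// subnn.
have h : e * (S + 1) <= \tr D / 2 by rewrite -ler_pdivlMr// mulrAC.
move: rest; rewrite ler_norml => /andP[h1 _].
move: (\sum_(_ < _) _) h1 => s h1.
have : 0 < e * (\tr D / 2) by rewrite mulr_gt0// divr_gt0.
have : 0 <= e * (\tr D / 2 - e * (S + 1)) by rewrite mulr_ge0 ?(ltW e0)// subr_ge0.
have : 0 <= e ^+ 2 by rewrite sqr_ge0.
by nra.
Qed.

End extremal.

(** * John's decomposition of the identity *)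

Section contact_decomposition.
Context {R : realType} {n : nat}.
Variable W : 'cV[R]_n -> R.
Hypothesis WZ : forall s u, 0 < s -> W (s *: u) = s * W u.
Hypothesis W_cvg : forall (T : Type) (F : set_system T) (FF : Filter F)
  (f : T -> 'cV[R]_n) (u : 'cV[R]_n),
  (forall k, f t k ord0 @[t --> F] --> u k ord0) -> W (f t) @[t --> F] --> W u.
Hypothesis W_ball : forall u, dotv u u <= W u ^+ 2.
Hypothesis W_max : forall B : 'M[R]_n,
  (forall u, dotv (B *m u) (B *m u) <= W u ^+ 2) -> \det B <= 1.

(* Together with [W_ball] this means [W u = |u|]. *)
Definition contact u := W u ^+ 2 <= dotv u u.

Lemma contactZ s u : 0 <= s -> contact u -> contact (s *: u).
Proof.
rewrite le_eqVlt => /orP[/eqP <-|s0] cu; rewrite /contact.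
  have W0 : W (0 : 'cV[R]_n) = 0 by have := @WZ 2 0 (ltr0Sn _ 1); rewrite scaler0; lra.
  by rewrite scale0r W0 expr0n/= dotv0l.
by rewrite WZ// exprMn dotvZl dotvZr mulrA -expr2 ler_wpM2l// sqr_ge0.
Qed.

Definition sqfrob m p (A : 'M[R]_(m, p)) : R := \sum_i \sum_j A i j ^+ 2.

Lemma sqfrob_ge0 m p (A : 'M[R]_(m, p)) : 0 <= sqfrob A.
Proof. by apply: sumr_ge0 => i _; apply: sumr_ge0 => j _; exact: sqr_ge0. Qed.

Lemma sqr_entry_le_sqfrob m p (A : 'M[R]_(m, p)) i j : A i j ^+ 2 <= sqfrob A.
Proof.
rewrite /sqfrob (bigD1 i)//= (bigD1 j)//= -addrA lerDl addr_ge0//.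
  by apply: sumr_ge0 => k _; exact: sqr_ge0.
by apply: sumr_ge0 => k _; apply: sumr_ge0 => l _; exact: sqr_ge0.
Qed.

Lemma sqfrob_eq0 m p (A : 'M[R]_(m, p)) : sqfrob A <= 0 -> A = 0.
Proof.
move=> A0; apply/matrixP => i j; rewrite mxE; apply/eqP.
by rewrite -sqrf_eq0 eq_le sqr_ge0 andbT (le_trans (sqr_entry_le_sqfrob _ _ _)).
Qed.

Definition frobdot m p (A B : 'M[R]_(m, p)) : R := \sum_i \sum_j A i j * B i j.

Lemma frobdotDr m p (A B C : 'M[R]_(m, p)) :
  frobdot A (B + C) = frobdot A B + frobdot A C.
Proof.
rewrite -big_split; apply: eq_bigr => i _; rewrite -big_split; apply: eq_bigr => j _.
by rewrite mxE mulrDr.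
Qed.

Lemma frobdot1 (A : 'M[R]_n) : frobdot A 1%:M = \tr A.
Proof.
apply: eq_bigr => i _; rewrite (bigD1 i)//= mxE eqxx mulr1 big1 ?addr0// => j ji.
by rewrite mxE eq_sym (negPf ji) mulr0.
Qed.

Lemma frobdot_rank1 (A : 'M[R]_n) v : frobdot A (v *m v^T) = dotv v (A *m v).
Proof.
rewrite dotvE; apply: eq_bigr => i _; rewrite mxE mulr_sumr; apply: eq_bigr => j _.
by rewrite mxE big_ord1 !mxE; ring.
Qed.

Lemma sqfrobB m p (A B : 'M[R]_(m, p)) s :
  sqfrob (A - s *: B) = sqfrob A - 2 * s * frobdot A B + s ^+ 2 * sqfrob B.
Proof.
rewrite /sqfrob /frobdot !mulr_sumr -sumrB -big_split; apply: eq_bigr => i _.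
rewrite /= !mulr_sumr -sumrB -big_split; apply: eq_bigr => j _.
by rewrite /= !mxE; ring.
Qed.

Lemma frobdot_self m p (A : 'M[R]_(m, p)) : frobdot A A = sqfrob A.
Proof. by apply: eq_bigr => i _; apply: eq_bigr => j _; rewrite expr2. Qed.

Lemma dotv_mulmx_le (A : 'M[R]_n) u :
  dotv (A *m u) (A *m u) <= sqfrob A * dotv u u.
Proof.
rewrite [leLHS]dotvE /sqfrob mulr_suml; apply: ler_sum => i _.
have -> : (A *m u) i ord0 = dotv (row i A)^T u.
  by rewrite dotvE mxE; apply: eq_bigr => j _; rewrite !mxE.
rewrite -expr2; apply: le_trans (dotv_CS _ _) _.
rewrite ler_wpM2r ?dotv_ge0// dotvE le_eqVlt; apply/orP; left; apply/eqP.
by apply: eq_bigr => j _; rewrite !mxE expr2.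
Qed.

(** If tr D were positive, [1%:M + e *: D1] would be admissible for small [e] with determinant above
    1. Passing from [D] to [D1] keeps half the trace and makes the quadratic form at most -d at unit
    contact vectors. *)
Lemma no_ascent (D : 'M[R]_n) :
  (forall v, contact v -> dotv v (D *m v) <= 0) -> \tr D <= 0.
Proof.
move=> HD; rewrite leNgt; apply/negP => trD.
have n0 : 0 < n%:R :> R.
  rewrite ltr0n lt0n; apply: contraTneq trD => n0.
  by rewrite -leNgt /mxtrace big1// => -[i hi] _; exfalso; move: hi; rewrite n0.
pose d := \tr D / (2 * n%:R); have d0 : 0 < d by rewrite divr_gt0// mulr_gt0.
pose D1 := D - d%:M.
have trD1 : 0 < \tr D1.
  rewrite raddfB /= mxtrace_scalar (_ : \tr D - _ = \tr D / 2); first by rewrite divr_gt0.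
  by rewrite /d -mulr_natl; field; rewrite gt_eqF.
have D1u u : dotv u (D1 *m u) = dotv u (D *m u) - d * dotv u u.
  by rewrite mulmxBl dotvBr mul_scalar_mx dotvZr.
have [e0 e00 He0] := det_gt1_near1 trD1.
pose C := 1 + sqfrob D1.
have C1 : 1 <= C by rewrite lerDl sqfrob_ge0.
have D1C u : dotv u u = 1 -> dotv (D1 *m u) (D1 *m u) <= C ^+ 2.
  move=> u1; apply: le_trans (dotv_mulmx_le _ _) _; rewrite u1 mulr1.
  have := sqfrob_ge0 D1; rewrite /C; move: (sqfrob D1) => q q0; nra.
have uD1C u : dotv u u = 1 -> dotv u (D1 *m u) <= C.
  move=> u1; have := dotv_CS u (D1 *m u); rewrite u1 mul1r => H.
  have := le_trans H (D1C u u1); rewrite -[leLHS]real_normK ?num_real//.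
  rewrite ler_sqr ?nnegrE// ?(le_trans ler01)//.
  exact/le_trans/ler_norm.
(* [E] is compact and free of contact vectors, so [W ^+ 2] exceeds 1 on it by a fixed [eta]; on the
   rest of the sphere the first-order term is negative. *)
pose E := [set u : 'cV[R]_n | dotv u u = 1 /\ - (d / 2) <= dotv u (D1 *m u)].
have [eta eta0 Heta] : exists2 eta, 0 < eta & forall u, E u -> 1 + eta <= W u ^+ 2.
  have [E0|/nonemptyPn nE] := pselect (E !=set0); last first.
    by exists 1 => // u; rewrite nE.
  have id_cvg (u : 'cV[R]_n) k : (fun t : 'cV[R]_n => t k ord0) t @[t --> nbhs u] --> u k ord0.
    exact: coord_continuous.
  have dot_c : continuous (fun u : 'cV[R]_n => dotv u u).
    by move=> u; exact: (cvg_dotv (nbhs_filter u) (id_cvg u) (id_cvg u)).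
  have D1_c : continuous (fun u : 'cV[R]_n => dotv u (D1 *m u)).
    move=> u; apply: (cvg_dotv (nbhs_filter u) (id_cvg u)).
    by apply: (cvg_mulmx_col (nbhs_filter u)) => *; [exact: cvg_cst|exact: id_cvg].
  have clE : closed E.
    apply: closedI.
      by move/continuous_closedP: dot_c => /(_ _ (closed_eq (y := 1))).
    by move/continuous_closedP: D1_c => /(_ _ (closed_ge (y := - (d / 2)))).
  have cE : compact E.
    apply: (@compact_matrix _ _ _ _ 1) => // u [u1 _] i j; rewrite ord1.
    by rewrite -ler_sqr ?nnegrE// expr1n real_normK ?num_real// -u1 sqr_coord_le_dotv.
  have WW_c : continuous (fun u : 'cV[R]_n => W u * W u).
    move=> u; have c := @W_cvg _ (nbhs u) (nbhs_filter u) (fun t => t) u (id_cvg u).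
    exact: (@cvgM _ _ _ (nbhs_filter u) _ _ _ _ c c).
  have [u0] := compact_EVT_min E0 cE (continuous_subspaceT WW_c).
  rewrite inE => -[u01 u0E] Hmin.
  have W1 : 1 < W u0 ^+ 2.
    rewrite ltNge; apply/negP => W1.
    have : contact u0 by rewrite /contact u01.
    by move=> /HD; move: u0E; rewrite D1u u01 mulr1; lra.
  exists (W u0 ^+ 2 - 1); first by rewrite subr_gt0.
  by move=> u Eu; rewrite subrKC !expr2; apply: Hmin; rewrite inE.
(* The four bounds, in order: the determinant exceeds 1; e^2 <= e; off [E] the term in e^2 is
   absorbed by e d; on [E] the increase is at most [eta]. *)
pose e := Num.min (Num.min e0 1) (Num.min (d / C ^+ 2) (eta / (2 * C + C ^+ 2))).
have C0 : 0 < C by exact: lt_le_trans C1.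
have CC0 : 0 < 2 * C + C ^+ 2 by rewrite addr_gt0 ?exprn_gt0 ?mulr_gt0.
have e_gt0 : 0 < e by rewrite /e !lt_min e00 ltr01 (divr_gt0 d0) ?(divr_gt0 eta0) ?exprn_gt0.
have /andP[ee0 e1] : (e <= e0) && (e <= 1) by rewrite -le_min /e ge_min lexx.
have : e <= Num.min (d / C ^+ 2) (eta / (2 * C + C ^+ 2)).
  by rewrite /e ge_min lexx orbT.
rewrite le_min => /andP[].
rewrite ler_pdivlMr ?exprn_gt0// => ed; rewrite ler_pdivlMr// => eeta.
have := He0 e e_gt0 ee0; rewrite ltNge => /negP; apply; apply: W_max.
have unit_case u : dotv u u = 1 ->
    dotv ((1%:M + e *: D1) *m u) ((1%:M + e *: D1) *m u) <= W u ^+ 2.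
  move=> u1; have h1 := D1C u u1; have h2 := uD1C u u1; have h3 := W_ball u.
  rewrite mulmxDl mul1mx -scalemxAl dotvDl !dotvDr !dotvZl !dotvZr (dotvC (D1 *m u) u) u1.
  rewrite u1 in h3.
  have h4 := Heta u; rewrite /E /= u1 in h4.
  move: h1 h2 h3 h4; move: (dotv _ (D1 *m u)) (dotv u _) (W u ^+ 2) => p q w h1 h2 h3 h4.
  have ep : e * (e * p) <= e * (e * C ^+ 2) by rewrite ler_wpM2l ?(ltW e_gt0)// ler_wpM2l// ltW.
  have [qd|qd] := leP (- (d / 2)) q.
    apply: le_trans (h4 (conj erefl qd)).
    have eq : e * q <= e * C by rewrite ler_wpM2l// ltW.
    have ee : e * (e * C ^+ 2) <= e * C ^+ 2.
      by rewrite ler_piMl// mulr_ge0 ?sqr_ge0// ltW.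
    by lra.
  apply: le_trans h3.
  have eq : e * q <= e * - (d / 2) by rewrite ler_wpM2l ?(ltW e_gt0)// ltW.
  have ee : e * (e * C ^+ 2) <= e * d by rewrite ler_wpM2l// ltW.
  by lra.
move=> u; have [->|u0] := eqVneq u 0; first by rewrite mulmx0 dotv0l sqr_ge0.
have uu : 0 < dotv u u by rewrite lt_def dotv_ge0 dotv_eq0 u0.
pose w := Num.sqrt (dotv u u); have w0 : 0 < w by rewrite sqrtr_gt0.
have w2 : w ^+ 2 = dotv u u by rewrite sqr_sqrtr// ltW.
have uE : u = w *: (w^-1 *: u) by rewrite scalerA divff ?gt_eqF// scale1r.
rewrite uE -scalemxAr dotvZl dotvZr WZ// exprMn mulrA -expr2 ler_wpM2l ?sqr_ge0//.
apply: unit_case; rewrite dotvZl dotvZr -w2.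
by field; rewrite gt_eqF.
Qed.

(** Caratheodory's argument: n^2 + 1 matrices v v^T are linearly dependent, and a multiple of the
    relation is subtracted until one coefficient vanishes. A fixed number of columns lets the later
    minimization run over a compact set. *)
Lemma caratheodory_gram (V : 'M[R]_(n, (n * n).+1)) :
  (forall j, contact (col j V)) -> exists V' : 'M[R]_(n, n * n),
    (forall j, contact (col j V')) /\ V' *m V'^T = V *m V^T.
Proof.
move=> cV.
pose G : 'M[R]_((n * n).+1, n * n) := \matrix_i mxvec (col i V *m (col i V)^T).
have nzK : kermx G != 0.
  rewrite kermx_eq0 /row_free neq_ltn; apply/orP; left.
  by rewrite ltnS rank_leq_col.
pose al := nz_row (kermx G).
have alG : al *m G = 0 by apply/sub_kermxP; exact: nz_row_sub.
have [i al0] : exists i, al ord0 i != 0.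
  apply/existsP; apply: contraT; rewrite negb_exists => /forallP H.
  have := nz_row_eq0 (kermx G); rewrite (negPf nzK) => /negbT/negP; case.
  apply/eqP/rowP => j; rewrite mxE; apply/eqP.
  by have := H j; rewrite negbK.
have alV k l : \sum_j al ord0 j * (V k j * V l j) = 0.
  have := congr1 (fun A : 'rV[R]_(n * n) => vec_mx A k l) alG.
  rewrite /= linear0 [in RHS]mxE => E; rewrite -[RHS]E mxE [RHS]mxE.
  by apply: eq_bigr => j _; rewrite mxE mxvecE mxE big_ord1 !mxE.
(* The sign makes some coefficient positive, hence also the largest one, at [i0]; so the new weights
   [t] are nonnegative and vanish at [i0]. *)
pose be j : R := Num.sg (al ord0 i) * al ord0 j.
have bei : 0 < be i by rewrite /be -normrEsg normr_gt0.
have beV k l : \sum_j be j * (V k j * V l j) = 0.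
  rewrite /be; under eq_bigr do rewrite -mulrA.
  by rewrite -mulr_sumr alV mulr0.
have [i0 _ i0max] : exists2 i0, true & forall j, be j <= be i0.
  by case: (Order.TotalTheory.arg_maxP be (isT : predT i)) => i0 _ H; exists i0 => // j; exact: H.
have b0 : 0 < be i0 by exact: lt_le_trans (i0max i).
pose t j := 1 - be j / be i0.
have t0 j : 0 <= t j by rewrite subr_ge0 ler_pdivrMr// mul1r.
have ti0 : t i0 = 0 by rewrite /t divff ?subrr// gt_eqF.
exists (\matrix_(k, j) (Num.sqrt (t (lift i0 j)) * V k (lift i0 j))); split.
  move=> j; rewrite (_ : col j _ = Num.sqrt (t (lift i0 j)) *: col (lift i0 j) V).
    by apply: contactZ => //; exact: sqrtr_ge0.
  by apply/colP => k; rewrite !mxE.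
apply/matrixP => k l; rewrite !mxE.
transitivity (\sum_j t j * (V k j * V l j)).
  rewrite (bigD1_ord i0)//= ti0 mul0r add0r; apply: eq_bigr => j _.
  rewrite !mxE mulrACA -expr2 sqr_sqrtr//.
rewrite /t; under eq_bigr do rewrite mulrBl mul1r [be _ / _]mulrC -mulrA.
rewrite sumrB -mulr_sumr beV mulr0 subr0.
by apply: eq_bigr => j _; rewrite mxE.
Qed.

Lemma le0_of_first_order (p q : R) :
  (forall s, 0 < s -> s < 1 -> 0 <= - (2 * s * p) + s ^+ 2 * q) -> p <= 0.
Proof.
move=> H; rewrite leNgt; apply/negP => p0.
pose s := Num.min 2^-1 (p / (`|q| + 1)).
have q10 : 0 < `|q| + 1 by rewrite ltr_wpDl.
have s0 : 0 < s by rewrite /s lt_min invr_gt0 ltr0n divr_gt0.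
have s1 : s < 1.
  by apply: (@le_lt_trans _ _ 2^-1); [rewrite /s ge_min lexx|rewrite invf_lt1// ltr1n].
have sp : s * (`|q| + 1) <= p by rewrite -ler_pdivlMr// /s ge_min lexx orbT.
have := H s s0 s1; rewrite [X in X <= _](_ : 0 = s * 0) ?mulr0//.
have -> : - (2 * s * p) + s ^+ 2 * q = s * (s * q - 2 * p) by ring.
rewrite pmulr_rge0//; have : s * q <= s * `|q| by rewrite ler_wpM2l ?ler_norm// ltW.
lra.
Qed.

Lemma gram_col_sum N (V : 'M[R]_(n, N)) : V *m V^T = \sum_j col j V *m (col j V)^T.
Proof.
apply/matrixP => k l; rewrite summxE mxE; apply: eq_bigr => j _.
by rewrite !mxE big_ord1 !mxE.
Qed.

(* Projecting the identity onto the closed convex cone generated by the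
   matrices [v *m v^T] with [v] a contact vector: the residual would be a
   direction along which the determinant increases. *)
Lemma contact_gram_identity : exists V : 'M[R]_(n, n * n),
  (forall j, contact (col j V)) /\ V *m V^T = 1%:M.
Proof.
have contact0 : contact 0.
  have W0 : W (0 : 'cV[R]_n) = 0 by have := @WZ 2 0 (ltr0Sn _ 1); rewrite scaler0; lra.
  by rewrite /contact W0 expr0n/= dotv0l.
pose f (V : 'M[R]_(n, n * n)) : R := sqfrob (1%:M - V *m V^T).
(* [n%:R] is the value of [f] at 0, so the cut makes the set bounded without losing the minimum. *)
pose S := [set V : 'M[R]_(n, n * n) | (forall j, contact (col j V)) /\ f V <= n%:R].
have gram_c (V : 'M[R]_(n, n * n)) k l :
    (U *m U^T) k l @[U --> nbhs V] --> (V *m V^T) k l.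
  rewrite mxE; under eq_fun do rewrite mxE.
  apply: (cvg_sumr (nbhs_filter V)) => j; rewrite mxE; under eq_fun do rewrite mxE.
  have cc i i' : U i i' @[U --> nbhs V] --> V i i' by exact: coord_continuous.
  exact: (@cvgM _ _ _ (nbhs_filter V) _ _ _ _ (cc k j) (cc l j)).
have f_c : continuous f.
  move=> V; apply: (cvg_sumr (nbhs_filter V)) => k; apply: (cvg_sumr (nbhs_filter V)) => l.
  have c : (1%:M - U *m U^T : 'M[R]_n) k l @[U --> nbhs V] --> (1%:M - V *m V^T : 'M[R]_n) k l.
    have E (U : 'M[R]_(n, n * n)) :
        (1%:M - U *m U^T : 'M[R]_n) k l = (1%:M : 'M[R]_n) k l - (U *m U^T) k l.
      by rewrite [LHS]mxE [X in _ + X]mxE.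
    rewrite E; under eq_fun do rewrite E.
    by apply: (@cvgB _ _ _ _ (nbhs_filter V)); [exact: cvg_cst|exact: gram_c].
  under eq_fun do rewrite expr2; rewrite expr2.
  exact: (@cvgM _ _ _ (nbhs_filter V) _ _ _ _ c c).
have clS : closed S.
  rewrite (_ : S = (\bigcap_(j in setT) [set V : 'M[R]_(n, n * n) |
      W (col j V) * W (col j V) - dotv (col j V) (col j V) <= 0]) `&`
      [set V | f V <= n%:R]).
    apply: closedI; last exact: closed_sublevel.
    apply: closed_bigI => j _; apply: closed_sublevel => V.
    have c k : (col j U) k ord0 @[U --> nbhs V] --> (col j V) k ord0.
      by rewrite mxE; under eq_fun do rewrite mxE; exact: coord_continuous.
    have c2 := @W_cvg _ (nbhs V) (nbhs_filter V) (col j) (col j V) c.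
    apply: (@cvgB _ _ _ _ (nbhs_filter V)).
      exact: (@cvgM _ _ _ (nbhs_filter V) _ _ _ _ c2 c2).
    exact: (cvg_dotv (nbhs_filter V)).
  apply/seteqP; split => V /= -[HV fV]; split => // j.
    by move=> _; rewrite /= subr_le0 -expr2; exact: HV.
  by have := HV j Logic.I; rewrite /= subr_le0 -expr2.
have bS V : S V -> forall k j, `|V k j| <= 1 + n%:R.
  move=> [_ fV] k j; set b := n%:R in fV *.
  have b0 : 0 <= b by [].
  have bb : b <= b ^+ 2.
    by rewrite /b -natrX ler_nat; case: (n) => // n'; rewrite -mulnn leq_pmulr.
  have := le_trans (sqr_entry_le_sqfrob (1%:M - V *m V^T) k k) fV.
  rewrite !mxE eqxx => H.
  have Vkj : V k j ^+ 2 <= \sum_i V k i * V^T i k.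
    rewrite (bigD1 j)//= mxE -expr2 lerDl sumr_ge0// => i _.
    by rewrite mxE -expr2 sqr_ge0.
  rewrite -ler_sqr ?nnegrE ?addr_ge0// real_normK ?num_real//.
  apply: le_trans Vkj _; move: (\sum_i _) H => x; rewrite -[true%:R]/(1 : R) => H.
  rewrite leNgt; apply/negP => xb.
  have yb : b < x - 1 by nra.
  have : 0 < (x - 1 - b) * (x - 1 + b) by rewrite mulr_gt0 ?subr_gt0// ltr_wpDr// (le_lt_trans b0).
  by nra.
have [V0] : exists2 V0, V0 \in S & forall V, V \in S -> f V0 <= f V.
  apply: compact_EVT_min; last exact: continuous_subspaceT.
    exists 0; split.
      by move=> j; rewrite (_ : col j 0 = 0)//; apply/colP => k; rewrite !mxE.
    rewrite /f mul0mx subr0 -frobdot_self frobdot1 mxtrace1 //.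
  exact: compact_matrix bS.
rewrite inE => -[cV0 fV0] V0min.
have {}V0min V : (forall j, contact (col j V)) -> f V0 <= f V.
  move=> cV; have [fV|fV] := leP (f V) n%:R; first by apply: V0min; rewrite inE.
  exact: le_trans fV0 (ltW fV).
exists V0; split => //.
pose M := V0 *m V0^T; pose D := 1%:M - M.
suff D0 : D = 0 by apply/esym/eqP; rewrite -subr_eq0; exact/eqP.
apply: sqfrob_eq0.
have Dcontact v : contact v -> dotv v (D *m v) <= 0.
  move=> cv; rewrite -frobdot_rank1.
  apply: (@le0_of_first_order _ (sqfrob (v *m v^T))) => s s0 s1.
  (* One more column adds s v v^T to the Gram matrix; [caratheodory_gram] then brings the number of
     columns back to n^2. *)
  pose V1 : 'M[R]_(n, (n * n).+1) := \matrix_(k, j)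
    if unlift ord0 j is Some j' then V0 k j' else Num.sqrt s * v k ord0.
  have V1E : V1 *m V1^T = M + s *: (v *m v^T).
    apply/matrixP => k l; rewrite !mxE big_ord_recl !mxE unlift_none addrC; congr (_ + _).
      by rewrite big_ord1 !mxE mulrACA -expr2 sqr_sqrtr// ltW.
    by apply: eq_bigr => j _; rewrite !mxE liftK.
  have cV1 j : contact (col j V1).
    have [->|] := eqVneq j ord0.
      rewrite (_ : col _ _ = Num.sqrt s *: v); first by apply: contactZ => //; exact: sqrtr_ge0.
      by apply/colP => k; rewrite !mxE unlift_none.
    rewrite eq_sym => /unlift_some[j' -> _].
    rewrite (_ : col _ _ = col j' V0); first exact: cV0.
    by apply/colP => k; rewrite !mxE liftK.
  have [V2 [cV2 V2E]] := caratheodory_gram cV1.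
  have := V0min V2 cV2; rewrite /f V2E V1E opprD addrA -/M -/D sqfrobB.
  by rewrite -addrA lerDl addrC.
(* Scaling [V0] by sqrt(1 - s) keeps its columns contact vectors, so minimality gives <D, M> >=
   0. *)
have DM : - frobdot D M <= 0.
  apply: (@le0_of_first_order _ (sqfrob M)) => s s0 s1.
  have cV j : contact (col j (Num.sqrt (1 - s) *: V0)).
    rewrite (_ : col _ _ = Num.sqrt (1 - s) *: col j V0); last by apply/colP => k; rewrite !mxE.
    by apply: contactZ => //; exact: sqrtr_ge0.
  have := V0min _ cV; rewrite /f linearZ /= -scalemxAl -scalemxAr scalerA -expr2.
  rewrite sqr_sqrtr ?subr_ge0 ?(ltW s1)// -/M.
  have -> : 1%:M - (1 - s) *: M = D - (- s) *: M.
    by rewrite scalerBl scale1r scaleNr opprK opprB addrA addrAC.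
  rewrite sqfrobB sqrrN -/D -addrA lerDl; congr (_ <= _); ring.
(* |D|^2 + <D, M> = <D, D + M> = <D, 1> = tr D <= 0. *)
have := no_ascent Dcontact; rewrite -frobdot1 -[1%:M](subrK M) -/D frobdotDr frobdot_self.
by lra.
Qed.

End contact_decomposition.

(** * From the decomposition to the slabs and the theorem *)

Section main.
Context {R : realType} {n : nat}.

(** A nonzero column v gives the direction v / |v| with weight |v|^2. A zero column gets weight 0
    and borrows the direction of column [j0], so that every [u i] is a unit vector. *)
Lemma contact_frame (W : 'cV[R]_n -> R) (V : 'M[R]_(n, n * n)) : (0 < n)%N ->
  (forall u, 0 <= W u) -> (forall s u, 0 < s -> W (s *: u) = s * W u) ->
  (forall u, dotv u u <= W u ^+ 2) ->
  (forall j, contact W (col j V)) -> V *m V^T = 1%:M ->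
  exists (c : 'I_(n * n) -> R) (u : 'I_(n * n) -> 'cV[R]_n),
    [/\ forall i, 0 <= c i, forall i, dotv (u i) (u i) = 1,
        frame_mx c u (fun=> 1) = 1%:M & forall i, W (u i) = 1].
Proof.
move=> n0 W0 WZ Wb cV VV.
pose w j := Num.sqrt (dotv (col j V) (col j V)).
have w2 j : w j ^+ 2 = dotv (col j V) (col j V) by rewrite sqr_sqrtr// dotv_ge0.
have w0 j : col j V != 0 -> 0 < w j.
  by move=> vj; rewrite sqrtr_gt0 lt_def dotv_ge0 dotv_eq0 vj.
have [j0 vj0] : exists j, col j V != 0.
  apply/existsP; apply: contraT; rewrite negb_exists => /forallP V0.
  have : (1%:M : 'M[R]_n) (Ordinal n0) (Ordinal n0) = 0.
    rewrite -VV gram_col_sum big1 ?mxE// => j _.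
    by have := V0 j; rewrite negbK => /eqP ->; rewrite mul0mx.
  by rewrite mxE eqxx => /eqP; rewrite oner_eq0.
pose j' j := if col j V != 0 then j else j0.
have vj' j : col (j' j) V != 0 by rewrite /j'; case: ifP.
pose u j := (w (j' j))^-1 *: col (j' j) V.
have u1 j : dotv (u j) (u j) = 1.
  rewrite dotvZl dotvZr -w2; field; by rewrite gt_eqF// w0.
exists (fun j => dotv (col j V) (col j V)), u; split => //.
- by move=> i; exact: dotv_ge0.
- rewrite /frame_mx -VV gram_col_sum; apply: eq_bigr => j _; rewrite mulr1.
  have [->|vj] := eqVneq (col j V) 0; first by rewrite dotv0l scale0r mul0mx.
  rewrite /u /j' vj linearZ /= -scalemxAl -scalemxAr !scalerA -w2.
  have -> : w j ^+ 2 / w j / w j = 1; last by rewrite scale1r.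
  by field; rewrite gt_eqF// w0.
- move=> j; have cu : contact W (u j).
    by apply: contactZ => //; rewrite invr_ge0 ltW// w0.
  have : W (u j) ^+ 2 = 1.
    by apply/eqP; rewrite eq_le; move: cu (Wb (u j)); rewrite /contact u1 => -> ->.
  by move/eqP; rewrite sqrf_eq1 => /orP[/eqP//|/eqP WN1]; have := W0 (u j); lra.
Qed.

End main.

Theorem theorem1p6 (R : realType) (n : nat) (n_gt0 : (0 < n)%N)
    (K : set 'cV[R]_n) (K_body : convex_body K) :
  exists A : 'M[R]_n,
    [/\ A \in unitmx,
        iwq (linear_image A K) <= 1 &
        (iwq (linear_image A K) = 1 <-> is_cube (linear_image A K))].
Proof.
case: K_body => cK _ Kint.
have [A [uA Wb Wmax]] := extremal_position cK Kint.
exists A; set K' := linear_image A K in Wb Wmax *.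
have [x0 /nbhs_ballP[e /= e0 He]] := Kint.
have Kx0 : K x0 by apply: He; exact: ballxx.
have cK' : compact K'.
  apply: continuous_compact => //; apply: continuous_subspaceT => x.
  apply: (@cvg_matrix _ _ _ _ _ (nbhs_filter x)) => i j; rewrite ord1.
  apply: (cvg_mulmx_col (nbhs_filter x)) => *; first exact: cvg_cst.
  exact: coord_continuous.
have K'0 : K' !=set0 by exists (A *m x0), x0.
have W0 := dirwidth_ge0 cK' K'0.
have WZ := dirwidthZ cK' K'0.
have [V [cV VV]] := contact_gram_identity WZ (cvg_dirwidth cK' K'0) Wb Wmax.
have [c [u [c0 u1 cu1 Wu]]] := contact_frame n_gt0 W0 WZ Wb cV VV.
(* The sides of the i-th slab are the two supporting hyperplanes of [K'] orthogonal to [u i], at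
   distance 1 by [Wu]. *)
pose a i := - support_fun K' (- u i).
have K'slab : K' `<=` slab_body u a 0.
  move=> x K'x i; rewrite /slab_pos opprK subr0 dotvC.
  have := support_ub cK' K'0 (u i) K'x; have := support_ub cK' K'0 (- u i) K'x.
  have := Wu i; rewrite /dirwidth dotvNr => ? ? ?; apply/andP; split; lra.
(* The image of [x0] is strictly inside each slab, because [x0] can move a little along [A^T *m u i]
   both ways within [K]. *)
have int i : exists2 r, 0 < r & r <= slab_pos u a i (A *m x0) <= 1 - r.
  pose w := A^T *m u i.
  have w0 : 0 < dotv w w.
    rewrite lt_def dotv_ge0 dotv_eq0 andbT; apply: contra_neq (oner_neq0 R) => w0.
    have uE : u i = 0 by rewrite -(mulKmx (_ : A^T \in unitmx) (u i)) ?unitmx_tr// -/w w0 mulmx0.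
    by rewrite -(u1 i) uE dotv0l.
  pose t := e / (2 * (`|w| + 1)).
  have w10 : 0 < `|w| + 1 by rewrite ltr_wpDl.
  have t0 : 0 < t by rewrite divr_gt0// mulr_gt0.
  have Kt v : `|v| = t * `|w| -> K' (A *m (x0 + v)).
    move=> vE; exists (x0 + v) => //; apply: He.
    rewrite mx_norm_ball /ball_/= opprD addNKr normrN vE.
    by rewrite /t mulrAC ltr_pdivrMr ?mulr_gt0// ltr_pM2l//; have := normr_ge0 w; lra.
  have /K'slab/(_ i) : K' (A *m (x0 + t *: w)) by apply: Kt; rewrite normrZ gtr0_norm.
  have /K'slab/(_ i) : K' (A *m (x0 - t *: w)).
    by apply: Kt; rewrite normrN normrZ gtr0_norm.
  rewrite !mulmxDr mulmxN -scalemxAr !slab_pos_shift dotvNr dotvZr.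
  rewrite (dotvC (u i)) dotv_mulmx -/w => /andP[h1 h2] /andP[h3 h4].
  exists (t * dotv w w); first by rewrite mulr_gt0.
  by apply/andP; split; lra.
have [rho rho0 x0rho] : exists2 rho, 0 < rho & slab_body u a rho (A *m x0).
  have /choice[r Hr] : forall i, exists r, 0 < r /\ r <= slab_pos u a i (A *m x0) <= 1 - r.
    by move=> i; have [r r0 ri] := int i; exists r.
  exists (\big[Num.min/1]_i r i).
    by apply: lt_bigmin => [|i _]; [exact: ltr01|have [] := Hr i].
  move=> i; have [_ /andP[h1 h2]] := Hr i.
  have bi : \big[Num.min/1]_j r j <= r i by exact: bigmin_le_cond.
  by apply/andP; split; lra.
have clK' : closed K' by apply: compact_closed => //; exact: norm_hausdorff.
(* All widths are at least 1 by [Wb], and the directions [u i] attain 1; hence the quotient reduces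
   to the volume. *)
have width1 : width K' = 1.
  have lb v : unit_sphere v -> 1 <= dirwidth K' v.
    move=> v1; rewrite -ler_sqr ?nnegrE// expr1n.
    by have <- : dotv v v = 1 by exact: v1.
  have nn0 : (0 < n * n)%N by rewrite muln_gt0 n_gt0.
  pose i0 := Ordinal nn0.
  apply/eqP; rewrite eq_le; apply/andP; split.
    rewrite -(Wu i0); apply: ge_inf; last by exists (u i0) => //; exact: u1.
    by exists 1 => _ [v v1 <-]; exact: lb.
  apply: lb_le_inf; first by exists (dirwidth K' (u i0)), (u i0) => //; exact: u1.
  by move=> _ [v v1 <-]; exact: lb.
have vol1 := volume_sub_slab_le1 c0 u1 cu1 rho0 x0rho clK' K'slab.
have volfin : volume K' \is a fin_num.
  by rewrite ge0_fin_numE ?volume_ge0// (le_lt_trans vol1)// ltry.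
have iwqE : iwq K' = fine (volume K') by rewrite /iwq width1 expr1n divr1.
split => //.
  by rewrite iwqE -lee_fin fineK.
split; last exact: iwq_cube.
rewrite iwqE => v1.
have vE : volume K' = 1%E by rewrite -(fineK volfin) v1.
have [Q [b [QQ K'box]]] := orth_mx c0 u1 cu1 rho0 x0rho clK' K'slab vE.
rewrite (closed_full_volume QQ clK' K'box vE).
exact: box_is_cube.
Qed.
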